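(* Let $A$ be a finite alphabet and let $L\subseteq A^*$ be a uniformly recurrent language on $A$, with $A\subseteq L$. If $L$ is connected and neutral, then the following conditions are equivalent: (1) Some return set of $L$ is a free subset of the free group $F(A)$ on $A$. (2) All return sets of $L$ are free subsets of the free group $F(A)$ on $A$. (3) $L$ is a tree set.
   Context: $F(A)$ is the free group on $A$, $A^*$ the set of words over $A$, $\varepsilon$ the empty word. A subset of $F(A)$ is called free if it forms a basis of the subgroup it generates. A language $L\subseteq A^*$ is recurrent if it is closed under taking factors and for all $u,v\in L$ there is a non-empty word $w$ with $uwv\in L$. It is uniformly recurrent if it is recurrent and for every $u\in L$ there is $N$ such that $u$ is a factor of every word of $L$ of length at least $N$. Extension graphs: for $w\in L$, let $\mathbf{L}(w)=\{a\in A: aw\in L\}$ and $\mathbf{R}(w)=\{b\in A: wb\in L\}$. The extension graph $\mathbf{E}(w)$ is the simple undirected bipartite graph whose vertex set is the disjoint union of (copies of) $\mathbf{L}(w)$ and $\mathbf{R}(w)$, with an edge between $a\in\mathbf{L}(w)$ and $b\in\mathbf{R}(w)$ iff $awb\in L$. $L$ is connected if $\mathbf{E}(w)$ is connected for every non-empty $w\in L$. A word $w\in L$ is neutral if $1-\chi(\mathbf{E}(w))=0$, where $\chi(\mathbf{E}(w))$ is the number of vertices minus the number of edges of $\mathbf{E}(w)$. $L$ is neutral if all its non-empty words are neutral. $L$ is a tree set if $\mathbf{E}(\varepsilon)$ is a forest and $\mathbf{E}(w)$ is a tree for every non-empty $w\in L$. Return sets: for words $u,v$ with $uv\in L$, the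 return set $\mathcal{R}_{u,v}$ is the set of all $r\in L$ such that $urv\in L$, $urv$ starts and ends with $uv$, and $urv$ contains exactly two occurrences of $uv$ (an occurrence of a word is a starting position; occurrences may overlap). The return sets of $L$ are the sets $\mathcal{R}_{u,v}$ for all pairs of words $(u,v)$ with $uv\in L$.
   Formalization: The alphabet A is assumed non-empty, and in condition (1) the return set must be R_{u,v} with uv non-empty, since R_{ε,ε} = A is always free, which would make (1) always true; condition (2) still ranges over all pairs. *)

(* Defs.v *)
(* MathComp world, with the classical sets of MathComp-Analysis. *)
From HB Require Import structures.
From mathcomp Require Import all_boot all_order all_algebra all_classical.
Set Implicit Arguments.
Unset Strict Implicit.
Unset Printing Implicit Defensive.

Local Open Scope classical_set_scope.

(** * Free groups *)

Section Letters.
Variable T : eqType.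
Implicit Types (x y : T * bool) (s t u : seq (T * bool)).

(* (a, false) stands for the generator a, and (a, true) for its inverse. *)
Definition inv_letter x : T * bool := (x.1, ~~ x.2).
#[local] Arguments inv_letter : simpl never.

Definition reduced s : bool := sorted (fun x y => y != inv_letter x) s.

Definition reduced_cons x s : seq (T * bool) :=
  if s is y :: s' then if y == inv_letter x then s' else x :: s else [:: x].

Definition reduced_mul s t : seq (T * bool) := foldr reduced_cons t s.

Definition reduced_inv s : seq (T * bool) := rev (map inv_letter s).

Lemma inv_letterK : involutive inv_letter.
Proof. by case=> a b; rewrite /inv_letter /= negbK. Qed.

Lemma reduced_behead x s : reduced (x :: s) -> reduced s.
Proof. exact: path_sorted. Qed.

Lemma reduced_consE x s : reduced (x :: s) -> reduced_cons x s = x :: s.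
Proof. by case: s => //= y s /andP[/negbTE-> _]. Qed.

Lemma reduced_cons_reduced x s : reduced s -> reduced (reduced_cons x s).
Proof.
case: s => //= y s rs; case: ifPn => [_ | yx]; first exact: path_sorted rs.
by rewrite /reduced /= yx.
Qed.

Lemma reduced_consK x s :
  reduced s -> reduced_cons (inv_letter x) (reduced_cons x s) = s.
Proof.
case: s => [|y s] /=; first by rewrite inv_letterK eqxx.
move=> rs; case: eqP => [yx | _]; last by rewrite /= inv_letterK eqxx.
by rewrite -yx reduced_consE.
Qed.

Lemma reduced_mul_reduced s t : reduced t -> reduced (reduced_mul s t).
Proof. by move=> rt; elim: s => //= x s; apply: reduced_cons_reduced. Qed.

Lemma reduced_inv_reduced s : reduced s -> reduced (reduced_inv s).
Proof.
rewrite /reduced /reduced_inv rev_sorted sorted_map.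
apply: sub_sorted => x y /=; apply: contra => /eqP eq_xy.
by rewrite eq_xy inv_letterK.
Qed.

Lemma reduced_mul_cons x s t :
  reduced t -> reduced_mul (reduced_cons x s) t = reduced_cons x (reduced_mul s t).
Proof.
move=> rt; case: s => //= y s; case: eqP => [-> | _] //.
by rewrite -{1}(inv_letterK x) reduced_consK ?reduced_mul_reduced.
Qed.

Lemma reduced_mulA s t u :
  reduced u -> reduced_mul s (reduced_mul t u) = reduced_mul (reduced_mul s t) u.
Proof. by move=> ru; elim: s => //= x s ->; rewrite reduced_mul_cons. Qed.

Lemma reduced_muls0 s : reduced s -> reduced_mul s [::] = s.
Proof.
elim: s => //= x s IHs rxs.
by rewrite IHs ?reduced_consE //; apply: reduced_behead rxs.
Qed.

Lemma reduced_invK : involutive reduced_inv.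
Proof.
by move=> s; rewrite /reduced_inv map_rev revK -map_comp map_id_in // => x _;
  apply: inv_letterK.
Qed.

Lemma reduced_mulVs s : reduced_mul (reduced_inv s) s = [::].
Proof.
elim: s => // x s IHs.
rewrite /reduced_mul /reduced_inv map_cons rev_cons foldr_rcons /=.
by rewrite inv_letterK eqxx; apply: IHs.
Qed.

End Letters.

Record free_group (T : choiceType) :=
  FreeGroup { fg_word :> seq (T * bool); fg_wordP : reduced fg_word }.

Section FreeGroup.
Variable T : choiceType.
Implicit Types s t u : free_group T.

HB.instance Definition _ := [isSub for @fg_word T].
HB.instance Definition _ := [Choice of free_group T by <:].

Definition fg_one : free_group T := @FreeGroup T [::] isT.
Definition fg_mul s t := FreeGroup (reduced_mul_reduced s (fg_wordP t)).
Definition fg_inv s := FreeGroup (reduced_inv_reduced (fg_wordP s)).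

Fact fg_mulA : associative fg_mul.
Proof. by move=> s t u; apply/val_inj/reduced_mulA/fg_wordP. Qed.
Fact fg_mul1g : left_id fg_one fg_mul.
Proof. by move=> s; apply/val_inj. Qed.
Fact fg_mulg1 : right_id fg_one fg_mul.
Proof. by move=> s; apply/val_inj/reduced_muls0/fg_wordP. Qed.
Fact fg_mulVg : left_inverse fg_one fg_inv fg_mul.
Proof. by move=> s; apply/val_inj/reduced_mulVs. Qed.
Fact fg_mulgV : right_inverse fg_one fg_inv fg_mul.
Proof.
by move=> s; apply/val_inj; rewrite /= -{1}(reduced_invK s) reduced_mulVs.
Qed.

HB.instance Definition _ := isGroup.Build (free_group T)
  fg_mulA fg_mul1g fg_mulg1 fg_mulVg fg_mulgV.

Definition fg_gen (a : T) : free_group T := @FreeGroup T [:: (a, false)] isT.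

(* The homomorphism out of the free group that extends a map f of the
   generators into a group. *)
Definition fg_lift (G : groupType) (f : T -> G) (s : free_group T) : G :=
  (\prod_(x <- fg_word s) (if x.2 then (f x.1)^-1 else f x.1))%g.

Lemma fg_lift_gen (G : groupType) (f : T -> G) a : fg_lift f (fg_gen a) = f a.
Proof. by rewrite /fg_lift big_seq1. Qed.

Lemma fg_lift_monoid_morphism (G : groupType) (f : T -> G) :
  monoid_morphism (fg_lift f).
Proof.
split=> [|s t]; first by rewrite /fg_lift big_nil.
rewrite /fg_lift /=; elim: (fg_word s) => [|x w IHw] /=.
  by rewrite big_nil mul1g.
rewrite big_cons -mulgA -IHw; case: (reduced_mul w t) => [|y v] /=.
  by rewrite big_seq1 big_nil mulg1.
case: eqP => [-> | _]; last by rewrite big_cons.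
rewrite big_cons mulgA /=; case: x.2 => /=; first by rewrite mulVg mul1g.
by rewrite mulgV mul1g.
Qed.

HB.instance Definition _ (G : groupType) (f : T -> G) :=
  isUMagmaMorphism.Build (free_group T) G (fg_lift f)
    (fg_lift_monoid_morphism f).

End FreeGroup.

(** * Bases and free subsets of a group *)

Definition gen_subgroup (G : groupType) (S : set G) : set G :=
  smallest [set H : set G | group_closed [in H]] S.

(* S is a basis of the subgroup H when the homomorphism from the free group on
   the set S that extends the inclusion of S is an isomorphism onto H. *)
Definition is_basis (G : groupType) (H S : set G) : Prop :=
  set_bij [set: free_group S] H (fg_lift (fun x : S => val x)).

Definition free_subset (G : groupType) (S : set G) : Prop :=
  is_basis (gen_subgroup S) S.

Definition word_fg (A : choiceType) (w : seq A) : free_group A :=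
  (\prod_(a <- w) fg_gen a)%g.

(** * Finite simple graphs *)

Record sgraph := SGraph {
  svertex :> finType;
  sedge : rel svertex;
  sedge_sym : symmetric sedge;
  sedge_irr : irreflexive sedge }.

Definition edge_set (G : sgraph) : {set {set G}} :=
  [set [set p.1; p.2]%SET | p : G * G & sedge p.1 p.2]%SET.

Definition euler_char (G : sgraph) : int := #|G|%:Z - #|edge_set G|%:Z.

Definition graph_connected (G : sgraph) : Prop :=
  forall x y : G, connect (@sedge G) x y.

(* A ucycle is a cyclic sequence of distinct vertices; those of length 2 merely
   go back and forth along one edge. *)
Definition forest (G : sgraph) : Prop :=
  forall s : seq G, ucycle (@sedge G) s -> (size s <= 2)%N.

Definition tree (G : sgraph) : Prop := graph_connected G /\ forest G.

(** * Languages *)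

Section Languages.
Variables (A : finType) (L : set (seq A)).

Definition recurrent : Prop :=
  (forall u v, infix u v -> L v -> L u) /\
  (forall u v, L u -> L v -> exists w, w != [::] /\ L (u ++ w ++ v)).

Definition uniformly_recurrent : Prop :=
  recurrent /\
  (forall u, L u ->
     exists N : nat, forall v, L v -> (N <= size v)%N -> infix u v).

(* inl a is the copy of a in L(w), and inr b is the copy of b in R(w). *)
Definition ext_vertices (w : seq A) : {set A + A} :=
  [set x | match x with
           | inl a => `[< L (a :: w) >]
           | inr b => `[< L (rcons w b) >]
           end]%SET.

Definition ext_edge (w : seq A) : rel {x : A + A | x \in ext_vertices w} :=
  fun x y => match val x, val y with
             | inl a, inr b | inr b, inl a => `[< L (a :: rcons w b) >]
             | _, _ => false
             end.

Fact ext_edge_sym w : symmetric (ext_edge (w := w)).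
Proof. by move=> x y; rewrite /ext_edge; case: (val x); case: (val y). Qed.

Fact ext_edge_irr w : irreflexive (ext_edge (w := w)).
Proof. by move=> x; rewrite /ext_edge; case: (val x). Qed.

Definition ext_graph (w : seq A) : sgraph :=
  SGraph (@ext_edge_sym w) (@ext_edge_irr w).

Definition connected_language : Prop :=
  forall w, L w -> w != [::] -> graph_connected (ext_graph w).

Definition neutral_word (w : seq A) : Prop :=
  (1 - euler_char (ext_graph w) = 0)%R.

Definition neutral_language : Prop :=
  forall w, L w -> w != [::] -> neutral_word w.

Definition tree_set : Prop :=
  forest (ext_graph [::]) /\
  (forall w, L w -> w != [::] -> tree (ext_graph w)).

(* The empty word occurs at each of the (size w).+1 positions of w. *)
Definition occurrences (x w : seq A) : nat :=
  #|[set i : 'I_(size w).+1 | prefix x (drop i w)]%SET|.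

(* Note that return_set [::] [::] is the set of the letters of L. *)
Definition return_set (u v : seq A) : set (seq A) :=
  [set r | [/\ L r, L (u ++ r ++ v),
               prefix (u ++ v) (u ++ r ++ v),
               suffix (u ++ v) (u ++ r ++ v) &
               occurrences (u ++ v) (u ++ r ++ v) = 2%N]].

Definition free_return_set (u v : seq A) : Prop :=
  free_subset (@word_fg A @` return_set u v).

End Languages.

(* Main.v *)
Require Import Defs.
From mathcomp Require Import all_boot all_order all_algebra all_classical.
From mathcomp Require Import all_fingroup zify.
Set Implicit Arguments.
Unset Strict Implicit.
Unset Printing Implicit Defensive.

(** Connectedness and neutrality say that the extension graph of a nonempty word
    of L is a tree, so L is a tree set exactly when the extension graph E of the
    empty word is a forest. Let c and e be the numbers of components and of edges
    of E, which has 2 |A| vertices; E is a forest if and only if 2 |A| = c + e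
    (forest_card). Fix a nonempty word u v of L, and let R be the return set of (u, v).

    First, neutrality determines the size of R: |R| + |A| = 1 + e
    (size_first_returns). The number of right extensions of a word minus 1 is
    additive over its left extensions, like a measure; summed over the words
    that start with their only occurrence of u v, it gives |R| - 1 on one hand
    and, by additivity, e - |A| on the other.

    Second, connectedness determines the possible values on R of a homomorphism
    from F(A) to a finite group Q. Suppose that f and f' : A -> Q agree on R.
    Inside a word of L, the defect (f x)^-1 (f' x) of the factor x that lies between an
    occurrence of u v, cut after u, and a later position depends on that
    position only, as two occurrences of u v are separated by a product of
    return words. Connectedness shows, by descent on the length of the context,
    that it depends only on the letter before the position (letter_states).
    Hence f' c = (g b)^-1 (f c) (g c) for all the words bc of L, for a function g
    on A that is constant on the left vertices of each component of E, and that
    is 1 at a base letter. There are |Q| ^ (c - 1) such gauge transformations, so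
    the restrictions of homomorphisms to R number |Q| ^ (|A| - c + 1)
    (card_restrict). Thus, for Q nontrivial, every map from R to Q extends to
    F(A) exactly when |R| = |A| - c + 1, which by the first count means that E is
    a forest.

    Third, R is free if and only if all the maps from R to finite groups extend
    to F(A). If they extend, R satisfies no relation, because free groups are
    residually finite (free_subset_extend). If R is free, they extend to the
    subgroup H generated by R, and then to F(A): letter_states, applied to the
    cosets of H instead of the elements of Q, gives representatives p with
    p(b) c p(c)^-1 in H for the words bc of L, and this expresses the return
    words through such elements of H, one for each letter
    (restrict_onto_of_free). Consequently the freeness of R does not depend on
    (u, v), and it is equivalent to E being a forest (free_return_setP). *)

(** * Counting with fibres of constant size *)

Section Counting.

Lemma card_const_fibers (X Y : finType) (h : X -> Y) (m : nat) :
  (forall x, #|[set x' | h x' == h x]%SET| = m) ->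
  #|X| = (#|[set h x | x : X]%SET| * m)%N.
Proof.
move=> hm; rewrite -sum_nat_const -sum1_card.
rewrite (@partition_big_imset _ _ _ _ _ h _ (fun=> 1%N)) /=.
apply: eq_bigr => _ /imsetP[x _ ->]; rewrite -(hm x) -sum1_card.
by apply: eq_bigl => x'; rewrite !inE.
Qed.

Definition edge_constant (V : finType) (Q : eqType) (e : rel V) (g : V -> Q) :=
  [forall x, forall y, e x y ==> (g x == g y)].

Lemma edge_constantP (V : finType) (Q : eqType) (e : rel V) (g : V -> Q) :
  reflect (forall x y, e x y -> g x = g y) (edge_constant e g).
Proof.
apply: (iffP forallP) => [h x y exy | h x].
  by move/forallP/(_ y)/implyP: (h x) => /(_ exy)/eqP.
by apply/forallP => y; apply/implyP => /h ->.
Qed.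

Lemma edge_constant_connect (V : finType) (Q : eqType) (e : rel V) (g : V -> Q) :
  edge_constant e g -> forall x y, connect e x y -> g x = g y.
Proof.
move/edge_constantP=> h x y /connectP[p]; elim: p x => [x _ -> //|z p IH x] /=.
by case/andP=> /h -> pz yl; apply: IH.
Qed.

(** A function that is constant along the edges is a choice of one value per
    component, that is, on the roots; q0 pads it outside the roots. *)
Lemma card_edge_constant (V Q : finType) (q0 : Q) (e : rel V) :
  connect_sym e ->
  #|[set g : {ffun V -> Q} | edge_constant e g]%SET| = (#|Q| ^ n_comp e V)%N.
Proof.
move=> esym.
pose res (g : {ffun V -> Q}) := [ffun x => if roots e x then g x else q0].
rewrite -(@card_in_imset _ _ res) => [|g g']; last first.
  rewrite !inE => hg hg' /ffunP eqr; apply/ffunP => x.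
  rewrite (edge_constant_connect hg (@connect_root _ e x)).
  rewrite (edge_constant_connect hg' (@connect_root _ e x)).
  by have := eqr (fingraph.root e x); rewrite !ffunE roots_root.
rewrite -[#|Q|]/(#|(predT : pred Q)|) -(card_pffun_on q0).
rewrite (fintype.eq_card (B := pffun_on q0 (predI (roots e) (mem V)) predT)) //.
move=> g; apply/imsetP/pffun_onP => [[g' _ ->] | [supp _]].
  split; last by [].
  by apply/fintype.subsetP => x; rewrite !inE ffunE; case: ifP; rewrite ?eqxx.
exists [ffun x => g (fingraph.root e x)].
  rewrite inE; apply/edge_constantP => x y exy.
  by rewrite !ffunE (fingraph.rootP esym (connect1 exy)).
apply/ffunP => x; rewrite !ffunE; case: ifP => [/eqP-> // | rx].
apply/eqP; apply: contraFT rx => gx.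
by move/fintype.subsetP/(_ x): supp; rewrite !inE => /(_ gx)/andP[].
Qed.

End Counting.

(** * Forests and the Euler characteristic *)

Section Graphs.
Variable G : sgraph.
Local Notation e := (@sedge G).

Lemma sedge_connect_sym : connect_sym e.
Proof. by apply: sym_connect_sym; apply: sedge_sym. Qed.

Lemma edge_setP (E : {set G}) :
  reflect (exists x y, e x y /\ E = [set x; y]%SET) (E \in edge_set G).
Proof.
apply: (iffP imsetP) => [[[x y]]|[x [y [exy ->]]]].
  by rewrite inE /= => exy ->; exists x, y.
by exists (x, y); rewrite ?inE.
Qed.

Lemma sedge_neq x y : e x y -> x != y.
Proof. by apply: contraTneq => ->; rewrite sedge_irr. Qed.

(** The coboundary of g with coefficients in Z/2. *)
Definition cut (g : G -> bool) : {set {set G}} :=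
  [set E in edge_set G | [exists x in E, exists y in E, g x != g y]]%SET.

Lemma mem_cut g x y : e x y -> ([set x; y]%SET \in cut g) = (g x != g y).
Proof.
move=> exy; rewrite inE; have -> /= : [set x; y]%SET \in edge_set G.
  by apply/edge_setP; exists x, y.
apply/exists_inP/idP => [[x' + /exists_inP[y']]|gxy].
  by rewrite !inE => /orP[]/eqP-> /orP[]/eqP->; rewrite ?eqxx // eq_sym.
by exists x; rewrite ?set21 //; apply/exists_inP; exists y; rewrite ?set22.
Qed.

Lemma cut_eqP g g' :
  (cut g == cut g') = edge_constant e (fun x => g x (+) g' x).
Proof.
apply/eqP/edge_constantP => [eqc x y exy|h].
  have := mem_cut g exy; rewrite eqc mem_cut //.
  by case: (g x) (g y) (g' x) (g' y) => [] [] [] [].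
apply/setP => E; case: (boolP (E \in edge_set G)) => [/edge_setP|nE]; last first.
  by rewrite !inE (negbTE nE).
case=> x [y [exy ->]]; rewrite !mem_cut //; move: (h x y exy).
by case: (g x) (g y) (g' x) (g' y) => [] [] [] [].
Qed.

Let cutf (g : {ffun G -> bool}) := cut g.

(** The coboundary map is additive, so that its fibres are the translates of its
    kernel, the 2 ^ c functions that are constant on each of the c components. *)
Lemma card_cuts : 2 ^ #|G| = (#|[set cutf g | g : {ffun G -> bool}]%SET| * 2 ^ n_comp e G)%N.
Proof.
rewrite -card_bool -card_ffun; apply: card_const_fibers => g.
rewrite -(card_edge_constant true sedge_connect_sym).
pose tr (f : {ffun G -> bool}) := [ffun x => f x (+) g x].
have trK : involutive tr by move=> f; apply/ffunP=> x; rewrite !ffunE addbK.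
rewrite -(card_imset _ (inv_inj trK)); apply: fintype.eq_card => f.
rewrite -[f]trK (mem_imset _ _ (inv_inj trK)) !inE /cutf cut_eqP trK.
by congr edge_constant; apply/funext => x; rewrite ffunE addbK.
Qed.

(** Surjectivity of the coboundary map. *)
Definition edge_sets_are_cuts :=
  forall F : {set {set G}}, F \subset edge_set G -> exists g, cut g = F.

Lemma edge_sets_are_cuts_card : edge_sets_are_cuts <-> #|G| = (n_comp e G + #|edge_set G|)%N.
Proof.
have sub : [set cutf g | g : {ffun G -> bool}]%SET \subset powerset (edge_set G).
  apply/fintype.subsetP => _ /imsetP[g _ ->]; rewrite inE; apply/fintype.subsetP => E.
  by rewrite inE => /andP[].
have cG := card_cuts; split=> [all|eqc].
  apply: (@expnI 2) => //; rewrite cG expnD mulnC; congr (_ * _)%N.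
  rewrite -card_powerset; apply: fintype.eq_card => F; apply/idP/idP => [|].
    exact: (fintype.subsetP sub).
  rewrite inE => /all[g <-]; apply/imsetP; exists [ffun x => g x] => //.
  by rewrite /cutf; congr cut; apply/funext => x; rewrite ffunE.
move=> F sF; suff : F \in [set cutf g | g : {ffun G -> bool}]%SET.
  by case/imsetP => g _ ->; exists g.
suff -> : [set cutf g | g : {ffun G -> bool}]%SET = powerset (edge_set G) by rewrite inE.
apply/eqP; rewrite eqEcard sub card_powerset /=.
by rewrite -(@leq_pmul2r (2 ^ n_comp e G)) ?expn_gt0 // -cG eqc expnD mulnC.
Qed.

Definition remove_edge (x y : G) : rel G := fun a b => e a b && ([set a; b]%SET != [set x; y]%SET).

Definition all_bridges := forall x y, e x y -> ~~ connect (remove_edge x y) x y.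

(** Any set of edges is a sum of singletons, and the singleton of xy is a cut
    exactly when removing xy separates x from y. *)
Lemma edge_sets_are_cuts_bridges : edge_sets_are_cuts <-> all_bridges.
Proof.
split=> [all x y exy | br F sF].
  have [|g cg] := all [set [set x; y]]%SET.
    by rewrite finset.sub1set; apply/edge_setP; exists x, y.
  apply/negP => cxy.
  have gc : edge_constant (remove_edge x y) g.
    apply/edge_constantP => a b /andP[eab nab]; apply/eqP; rewrite -[_ == _]negbK.
    by rewrite -mem_cut // cg inE.
  have := mem_cut g exy; rewrite (edge_constant_connect gc cxy) eqxx cg.
  by rewrite inE eqxx.
have sepE (E : {set G}) : exists g : G -> bool, E \in edge_set G -> cut g = [set E]%SET.
  case: (boolP (E \in edge_set G)) => [/edge_setP[x [y [exy ->]]]|]; last by exists xpredT.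
  exists (fun z => connect (remove_edge x y) x z) => _.
  apply/setP=> E'; rewrite [RHS]inE.
  case: (boolP (E' \in edge_set G)) => [/edge_setP[a [b [eab ->]]]|nE]; last first.
    rewrite inE (negbTE nE); apply/esym/negbTE; apply: contraNneq nE => ->.
    by apply/edge_setP; exists x, y.
  rewrite mem_cut //; case: ([set a; b]%SET =P [set x; y]%SET) => [eqab|/eqP nab].
    have [aE bE] : a \in [set x; y]%SET /\ b \in [set x; y]%SET.
      by rewrite -eqab !inE !eqxx orbT.
    have := sedge_neq eab; move: aE bE; rewrite !inE.
    by case/orP=> /eqP-> /orP[]/eqP->; rewrite ?eqxx // connect0 (negbTE (br _ _ exy)).
  have dab : remove_edge x y a b by rewrite /remove_edge eab.
  have dba : remove_edge x y b a by rewrite /remove_edge sedge_sym eab finset.setUC.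
  apply/negbTE; rewrite negbK; apply/eqP.
  by apply/idP/idP => h; apply: connect_trans h (connect1 _).
have [sep sepP] := choice sepE.
exists (fun x => \big[addb/false]_(E in F) sep E x).
apply/setP => E; case: (boolP (E \in edge_set G)) => [eE|nE]; last first.
  by rewrite inE (negbTE nE); apply/esym/negbTE; apply: contraNN nE => /(fintype.subsetP sF).
have /edge_setP[x [y [exy eqE]]] := eE; rewrite eqE mem_cut // -eqE.
rewrite -[_ != _]/(~~ (_ == _)) -[_ == _]negbK -negb_add negbK -big_split /=.
under eq_bigr => E' E'F.
  have -> : sep E' x (+) sep E' y = (E' == E).
    have := mem_cut (sep E') exy; rewrite sepP ?(fintype.subsetP sF) // inE -eqE eq_sym => ->.
    by case: (sep E' x) (sep E' y) => [] [].
  over.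
case: (boolP (E \in F)) => EF.
  rewrite (bigD1 E) //= eqxx big1 // => E' /andP[_ /negbTE] //.
by rewrite big1 // => E' E'F; apply: contraNF EF => /eqP <-.
Qed.

Lemma set2_inj_l (a b b' : G) : [set a; b]%SET = [set a; b']%SET -> b = b'.
Proof.
move=> eqs; have : b \in [set a; b']%SET by rewrite -eqs set22.
rewrite !inE => /orP[/eqP eqb|/eqP //].
have : b' \in [set a; b]%SET by rewrite eqs set22.
by rewrite !inE -eqb orbb => /eqP.
Qed.

(** A path from x to y that avoids the edge xy closes up, with xy, to a cycle of
    length at least 3; conversely the rest of a cycle through xy is
    such a path. *)
Lemma forest_all_bridges : forest G <-> all_bridges.
Proof.
split=> [fo x y exy | br [//|x [//|y [//|z s]]]].
  apply/negP => /connectP[p pp]; case: (shortenP pp) => q pq uq _ lq.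
  have := fo (x :: q); rewrite /ucycle uq andbT (cycle_path x) /= -lq.
  rewrite (sedge_sym y) exy /=.
  rewrite (@sub_path _ (remove_edge x y)) => [|a b /andP[] //|//] => /(_ isT).
  case: q pq uq lq => [|a [|b q]] //= => [_ _ yx|/andP[+ _] _ ya] _.
    by move: exy; rewrite yx sedge_irr.
  by rewrite /remove_edge -ya eqxx andbF.
case/andP => /= /andP[exy cyc] /and3P[xn yn un].
exfalso; move: (br x y exy); rewrite (sym_connect_sym _); last first.
  by move=> a b; rewrite /remove_edge sedge_sym finset.setUC.
case/negP.
have avoid a t : path e a t -> y \notin a :: t -> path (remove_edge x y) a t.
  elim: t a => //= b t IH a /andP[eab pt]; rewrite inE negb_or => /andP[ya yt].
  rewrite IH // andbT /remove_edge eab; apply: contraNneq ya => eqs.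
  have : y \in [set a; b]%SET by rewrite eqs set22.
  by move: yt; rewrite !inE negb_or => /andP[/negbTE-> _]; rewrite orbF.
have /andP[eyz pz] : e y z && path e z (rcons s x) by [].
apply: (@connect_trans _ _ z).
  apply: connect1; rewrite /remove_edge eyz; apply: contra xn => /eqP.
  by rewrite [RHS]finset.setUC => /set2_inj_l ->; rewrite !inE eqxx orbT.
apply/connectP; exists (rcons s x); last by rewrite last_rcons.
apply: avoid => //; rewrite -rcons_cons mem_rcons inE negb_or yn andbT.
by rewrite eq_sym sedge_neq.
Qed.

(** In general the number of vertices is at most the number of components plus
    the number of edges: this is the dimension count for the coboundary map,
    whose surjectivity characterizes forests. *)
Lemma forest_card : forest G <-> #|G| = (n_comp e G + #|edge_set G|)%N.
Proof. by rewrite forest_all_bridges -edge_sets_are_cuts_bridges edge_sets_are_cuts_card. Qed.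

End Graphs.

(** * Free groups are residually finite *)

Section ResidualFiniteness.
Local Open Scope group_scope.

(** Partial injections of a finite set, given by their graphs, extend to
    permutations: compose with a transposition to correct one value at a time. *)
Lemma partial_perm (X : finType) (l : seq (X * X)) :
  uniq (unzip1 l) -> uniq (unzip2 l) ->
  exists p : {perm X}, forall q, q \in l -> p q.1 = q.2.
Proof.
elim: l => [_ _|[x y] l IH /= /andP[xl u1] /andP[yl u2]]; first by exists 1.
have [p hp] := IH u1 u2.
exists (p * tperm (p x) y) => -[a b]; rewrite inE permM.
case: eqP => [[-> ->] _|_ /= ab]; first by rewrite tpermL.
have ax : a != x by apply: contraNneq xl => <-; apply: (map_f fst ab).
have by' : b != y by apply: contraNneq yl => <-; apply: (map_f snd ab).
rewrite (hp _ ab) tpermD 1?eq_sym // -[b](hp _ ab) /=.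
by rewrite (inj_eq perm_inj).
Qed.

(** Let the letters of a reduced word of length n act partially on the points
    0, ..., n, the i-th one moving i to i + 1. Reducedness says that each
    generator acts by a partial injection; once these are extended to
    permutations, the word moves 0 to n. *)
Lemma free_group_residually_finite (T : choiceType) (s : free_group T) :
  s != 1 -> exists (X : finType) (f : T -> {perm X}), fg_lift f s != 1.
Proof.
move=> s1; have [x0 s'] : exists x0 : T * bool, size s != 0%N.
  case: s s1 => [[|x w] rw] s1; last by exists x.
  by case/eqP: s1; apply: val_inj.
set n := size s in s' *.
have /(sortedP x0) red : reduced s by apply: fg_wordP.
pose step i : 'I_n.+1 * 'I_n.+1 :=
  if (nth x0 s i).2 then (inord i.+1, inord i) else (inord i, inord i.+1).
pose l a := [seq i <- iota 0 n | (nth x0 s i).1 == a].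
have lP a i : i \in l a -> (i < n)%N /\ (nth x0 s i).1 = a.
  by rewrite mem_filter mem_iota => /andP[/eqP-> /= ->].
have inord_inj (i j : nat) : (i <= n)%N -> (j <= n)%N ->
    inord i = inord j :> 'I_n.+1 -> i = j.
  by move=> ni nj /(congr1 val) /=; rewrite !inordK.
(* Two different steps of one generator can only share a source or a target if
   they are consecutive and mutually inverse. *)
have clash i : (i.+1 < n)%N -> (nth x0 s i).1 = (nth x0 s i.+1).1 ->
    (nth x0 s i).2 = ~~ (nth x0 s i.+1).2 -> False.
  move=> ni e1 e2; case/negP: (red i ni); apply/eqP.
  by rewrite /inv_letter e1 e2 negbK; case: (nth _ _ _).
have perm_of a : exists p : {perm 'I_n.+1},
    forall i, i \in l a -> p (step i).1 = (step i).2.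
  have ul : uniq (l a) by rewrite filter_uniq ?iota_uniq.
  have [|| p hp] := @partial_perm _ [seq step i | i <- l a].
  - rewrite /unzip1 /unzip2 -map_comp map_inj_in_uniq // => i j /lP[ni ai] /lP[nj aj] /=.
    have e1 : (nth x0 s i).1 = (nth x0 s j).1 by rewrite ai aj.
    rewrite /step; case: ifP => si; case: ifP => sj /=;
      move/inord_inj => /(_ (ltac:(lia)) (ltac:(lia))) eqij; try lia.
      by case: (@clash i); rewrite ?eqij // si sj.
    by case: (@clash j); rewrite -?eqij // si sj.
  - rewrite /unzip1 /unzip2 -map_comp map_inj_in_uniq // => i j /lP[ni ai] /lP[nj aj] /=.
    have e1 : (nth x0 s i).1 = (nth x0 s j).1 by rewrite ai aj.
    rewrite /step; case: ifP => si; case: ifP => sj /=;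
      move/inord_inj => /(_ (ltac:(lia)) (ltac:(lia))) eqij; try lia.
      by case: (@clash j); rewrite -?eqij // si sj.
    by case: (@clash i); rewrite ?eqij // si sj.
  by exists p => i il; apply: (hp (step i)); apply: map_f.
have [f fP] := boolp.choice perm_of.
exists 'I_n.+1, f; apply/eqP => fs1.
have walk k : (k <= n)%N ->
    (\prod_(x <- take k s) (if x.2 then (f x.1)^-1 else f x.1)) ord0 = inord k.
  elim: k => [_|k IH kn]; first by rewrite take0 big_nil perm1; apply/val_inj; rewrite /= inordK.
  rewrite (take_nth x0) // big_rcons /= permM IH 1?ltnW //.
  have kl : k \in l (nth x0 s k).1 by rewrite mem_filter eqxx mem_iota.
  have := fP _ _ kl; rewrite /step; case: ifP => _ //= <-.
  by rewrite permK.
have := walk n (leqnn n); rewrite take_size.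
move: fs1; rewrite /fg_lift => ->; rewrite perm1 => /(congr1 val)/=.
by rewrite inordK // => n0; rewrite -n0 in s'.
Qed.
End ResidualFiniteness.

(** * Subgroups and free subsets *)

Section FreeSubsets.
Local Open Scope group_scope.

Lemma fg_lift_comp (T : choiceType) (G H : groupType)
    (h : UMagmaMorphism.type G H) (f : T -> G) (s : free_group T) :
  h (fg_lift f s) = fg_lift (h \o f) s.
Proof.
rewrite /fg_lift gmulf_prod; apply: eq_bigr => x _ /=.
by case: ifP => // _; rewrite gmulfV.
Qed.

Lemma eq_fg_lift (T : choiceType) (G : groupType) (f g : T -> G) :
  f =1 g -> fg_lift f =1 fg_lift g.
Proof. by move=> fg s; apply: eq_bigr => x _; rewrite fg. Qed.

Lemma fg_word_word_fg (A : choiceType) (w : seq A) :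
  fg_word (word_fg w) = [seq (a, false) | a <- w].
Proof.
elim: w => [|a w IH]; first by rewrite /word_fg big_nil.
rewrite /word_fg big_cons /= -/(word_fg w) IH; case: w {IH} => //= b w.
by rewrite /inv_letter /= xpair_eqE andbF.
Qed.

Lemma word_fg_inj (A : choiceType) : injective (@word_fg A).
Proof.
move=> w w' /(congr1 (@fg_word A)); rewrite !fg_word_word_fg.
by apply: inj_map => a b [].
Qed.

Lemma fg_lift_word (A : choiceType) (G : groupType) (f : A -> G) (w : seq A) :
  fg_lift f (word_fg w) = \prod_(a <- w) f a.
Proof. by rewrite /word_fg gmulf_prod; apply: eq_bigr => a _; apply: fg_lift_gen. Qed.

Lemma gen_subgroup_sub (G : groupType) (S : set G) : (S `<=` gen_subgroup S)%classic.
Proof. exact: sub_smallest. Qed.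

Lemma gen_subgroup_closed (G : groupType) (S : set G) :
  group_closed [in gen_subgroup S].
Proof.
split=> [|x y xS yS]; first by apply/mem_set => H [[/set_mem H1 _] _].
apply/mem_set => H /[dup] HP [[_ HF] _]; apply/set_mem/HF.
  by apply/mem_set; move/set_mem: xS; apply.
by apply/mem_set; move/set_mem: yS; apply.
Qed.

Section Subgroup.
Variables (G : groupType) (S : set G).
Local Notation H := (gen_subgroup S).
Lemma gen_subgroup1 : H 1. Proof. by have [/set_mem] := gen_subgroup_closed S. Qed.
Lemma gen_subgroupM x y : H x -> H y -> H (x * y).
Proof.
move=> hx hy; apply/set_mem; apply: (group_closedM (gen_subgroup_closed S)); exact/mem_set.
Qed.
Lemma gen_subgroupV x : H x -> H x^-1.
Proof.
move=> hx; apply/set_mem; apply: (group_closedV (gen_subgroup_closed S)); exact/mem_set.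
Qed.

Local Notation lift := (fg_lift (fun x : S => val x)).

(** The homomorphism from the free group on S always maps onto the subgroup that
    S generates, so that only injectivity is at stake in freeness. *)
Lemma gen_subgroup_range : (range lift = H)%classic.
Proof.
apply/seteqP; split=> [_ [s _ <-]|].
  rewrite /fg_lift; elim/big_rec: _ => [|[x b] y _ hy]; first exact: gen_subgroup1.
  apply: gen_subgroupM hy => /=; have hx : H (val x) by exact: gen_subgroup_sub (set_mem (valP x)).
  by case: b => //; apply: gen_subgroupV.
apply: smallest_sub => [|x Sx]; last first.
  by exists (fg_gen (SigSub (mem_set Sx) : S)); rewrite ?fg_lift_gen.
split=> [|_ _ /set_mem[s _ <-] /set_mem[t _ <-]].
  by apply/mem_set; exists 1; rewrite ?gmulf1.
by apply/mem_set; exists (s * t^-1); rewrite ?gmulfF.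
Qed.

Lemma free_subsetP :
  free_subset S <-> (forall s : free_group S, lift s = 1 -> s = 1).
Proof.
split=> [[_ inj _] s s1|ker].
  apply: inj; [exact: mem_set | exact: mem_set |].
  by rewrite s1 gmulf1.
split.
- by move=> s _; rewrite -gen_subgroup_range; exists s.
- by move=> s t _ _; apply: gmulf_inj.
by rewrite -gen_subgroup_range; move=> x.
Qed.
End Subgroup.

(** A nontrivial relation between the elements of S is violated in some finite
    permutation group by values of the elements of S, but homomorphisms out of
    the whole group satisfy it. *)
Lemma free_subset_extend (T : choiceType) (S : set (free_group T)) :
  (forall (X : finType) (phi : S -> {perm X}),
     exists f : T -> {perm X}, forall x : S, fg_lift f (val x) = phi x) ->
  free_subset S.
Proof.
move=> ext; apply/free_subsetP => s s1; apply/eqP; apply: contraT => /free_group_residually_finite.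
case=> X [phi]; have [f fphi] := ext X phi.
by rewrite -(eq_fg_lift fphi) -(fg_lift_comp (fg_lift f) val) s1 gmulf1 eqxx.
Qed.

End FreeSubsets.

(** * First returns to a word *)

Section Prefix.
Variable T : eqType.
Implicit Types a b z : seq T.

Lemma prefix_of_prefix a b z :
  prefix a z -> prefix b z -> (size a <= size b)%N -> prefix a b.
Proof.
rewrite !prefixE => /eqP za /eqP zb ab.
by rewrite -zb take_takel // za.
Qed.

Lemma suffix_of_suffix a b z :
  suffix a z -> suffix b z -> (size a <= size b)%N -> suffix a b.
Proof.
by rewrite /suffix => za zb ab; apply: prefix_of_prefix za zb _; rewrite !size_rev.
Qed.

Lemma suffix_prefix_drop a z : (size a <= size z)%N ->
  suffix a z = prefix a (drop (size z - size a) z).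
Proof.
move=> az; rewrite suffixE prefixE take_oversize // size_drop; lia.
Qed.
End Prefix.

Section Return.
Variables (A : finType) (L : set (seq A)).
Implicit Types u v w z r : seq A.

(** The complete first return words: with w = u v, the return words r of the
    pair (u, v) correspond to these words by r |-> u r v, so that their number
    depends on w only. *)
Definition first_return w z :=
  [/\ L z, prefix w z, suffix w z, (size w < size z)%N &
      forall i, (0 < i < size z - size w)%N -> ~~ prefix w (drop i z)].

Lemma occurrences_first_return w z :
  L z -> prefix w z -> suffix w z ->
  occurrences w z = 2%N <-> first_return w z.
Proof.
move=> Lz pz sz; have wz := size_prefix pz; rewrite /occurrences.
set O := [set i | _]%SET.
have O0 : ord0 \in O by rewrite inE drop0.
have sub_lt : (size z - size w < (size z).+1)%N by lia.
pose o1 := Ordinal sub_lt.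
have O1 : o1 \in O by rewrite inE -suffix_prefix_drop.
have O_le (i : 'I_(size z).+1) : i \in O -> (i <= size z - size w)%N.
  case: i => i i_lt; rewrite inE => /size_prefix; rewrite size_drop /= => le; lia.
split=> [O2|[_ _ _ lt_wz no]].
  have lt_wz : (size w < size z)%N.
    rewrite ltn_neqAle wz andbT; apply/eqP => eq_s.
    have : O = [set ord0]%SET.
      apply/setP => i; rewrite inE; apply/idP/eqP => [/O_le i0|-> //].
      by apply/val_inj => /=; lia.
    by move=> O1'; move: O2; rewrite O1' cards1.
  split=> // i /andP[i0 i1]; apply/negP => pi.
  have lti : (i < (size z).+1)%N by lia.
  have : (#|[set ord0; o1; Ordinal lti]%SET| <= 2)%N.
    rewrite -O2; apply/subset_leq_card/fintype.subsetP => j.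
    by rewrite !inE -orbA => /or3P[]/eqP->; rewrite ?drop0 -?suffix_prefix_drop.
  rewrite -finset.setUC cardsU1 cards2 !inE /= -!val_eqE /=; lia.
have -> : O = [set ord0; o1]%SET.
  apply/setP => i; rewrite !inE; apply/idP/orP => [pi|[]/eqP->]; last first.
  - by rewrite -suffix_prefix_drop.
  - by rewrite drop0.
  have il : (i <= size z - size w)%N by apply: O_le; rewrite inE.
  rewrite -!val_eqE /=; case: (posnP i) => [->|i0]; [by left|right].
  by apply: contraT => i1; have := no i; rewrite pi => /(_ (ltac:(lia))).
by rewrite cards2 -val_eqE /=; lia.
Qed.

Hypothesis L_fact : forall u v, infix u v -> L v -> L u.

Lemma factor_mid x y z : L (x ++ y ++ z) -> L y.
Proof. by apply: L_fact; apply/infixP; exists x, z. Qed.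
Lemma factor_l x y : L (x ++ y) -> L x.
Proof. exact: (@factor_mid [::]). Qed.
Lemma factor_r x y : L (x ++ y) -> L y.
Proof. by move=> Lxy; apply: (@factor_mid x y [::]); rewrite cats0. Qed.

Lemma return_setE u v r : return_set L u v r <-> first_return (u ++ v) (u ++ r ++ v).
Proof.
split=> [[_ Lz pz sz]|/[dup] fr [Lz pz sz _ _]].
  by move/occurrences_first_return; apply.
split=> //; first exact: factor_mid Lz.
exact/occurrences_first_return.
Qed.

Section States.
Variables (u v : seq A) (X : Type) (act : A -> X -> X) (x0 : X).
Hypothesis act_inj : forall c, injective (act c).
Definition run := foldl (fun x c => act c x).
Hypothesis ret_fix : forall r, return_set L u v r -> run x0 r = x0.

Lemma run_cat x s t : run x (s ++ t) = run (run x s) t.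
Proof. exact: foldl_cat. Qed.

Lemma run_inj s : injective (run^~ s).
Proof. by elim: s => //= c s IH x y /IH/act_inj. Qed.

(** Cut t at the successive occurrences of u v in u t v: the pieces are return
    words. *)
Lemma run_between t :
  L (u ++ t ++ v) -> prefix (u ++ v) (u ++ t ++ v) ->
  suffix (u ++ v) (u ++ t ++ v) -> run x0 t = x0.
Proof.
have [n] := ubnP (size t); elim: n t => // n IH t lt_n Lz pz sz.
case: (posnP (size t)) => [/size0nil-> //|t0].
have [[i i_lt pi]|none] := pselect (exists2 i, (0 < i < size t)%N &
    prefix (u ++ v) (drop i (u ++ t ++ v))); last first.
  apply/ret_fix/return_setE; split=> //; first by rewrite !size_cat; lia.
  move=> i i_lt; apply/negP => pi; apply: none; exists i => //.
  by move: i_lt; rewrite !size_cat; lia.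
set z := u ++ t ++ v in Lz pz sz pi *.
set t1 := take i t; set t2 := drop i t; have tE : t = t1 ++ t2 by rewrite cat_take_drop.
have st1 : size t1 = i by rewrite size_takel //; lia.
have st2 : size t2 = (size t - i)%N by rewrite size_drop.
have [q dq] := prefixP pi.
have zE : z = (take i z ++ u) ++ v ++ q by rewrite -[LHS](cat_take_drop i) dq !catA.
have stz : size (take i z) = i by rewrite size_takel // /z !size_cat; lia.
have ut1 : u ++ t1 = take i z ++ u.
  have := congr1 (take (i + size u)) zE; rewrite take_size_cat ?size_cat ?stz // => <-.
  rewrite /z tE -!catA catA take_size_cat //; rewrite size_cat st1; lia.
have zE1 : z = (u ++ t1 ++ v) ++ q by rewrite zE -ut1 -!catA.
have zE2 : z = take i z ++ (u ++ t2 ++ v) by rewrite catA -ut1 /z tE -!catA.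
rewrite tE run_cat !IH //.
- by rewrite st2; lia.
- by apply: (@factor_r (take i z)); rewrite -zE2.
- by have := pi; rewrite {1}zE2 drop_size_cat.
- apply: suffix_of_suffix sz _ _; last by rewrite !size_cat; lia.
  by rewrite zE2 suffix_suffix.
- by rewrite st1; lia.
- by apply: (@factor_l _ q); rewrite -zE1.
- apply: prefix_of_prefix pz _ _; last by rewrite !size_cat; lia.
  by rewrite zE1 prefix_prefix.
by rewrite catA ut1 -catA suffix_suffix.
Qed.

(** Read y with the automaton act after resetting the state to x0 at some
    occurrence of u v, at the position between u and v. *)
Definition state_after (y : seq A) (x : X) :=
  exists y1 y2, y = y1 ++ u ++ v ++ y2 /\ x = run x0 (v ++ y2).

(** The state does not depend on the occurrence of u v, because two occurrences
    are separated by a product of return words, which fix x0. *)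
Lemma state_after_uniq y x x' : L y -> state_after y x -> state_after y x' -> x = x'.
Proof.
have wl y1 y2 y1' y2' : L (y1 ++ u ++ v ++ y2) -> y1 ++ u ++ v ++ y2 = y1' ++ u ++ v ++ y2' ->
    (size y1 <= size y1')%N -> run x0 (v ++ y2) = run x0 (v ++ y2').
  move=> Ly eqy le.
  have [q dq] : exists q, y1' = y1 ++ q.
    exists (drop (size y1) y1'); have := congr1 (take (size y1)) eqy.
    rewrite take_size_cat // take_cat ltn_neqAle le andbT.
    by case: eqP => /= [->|_ {1}->]; rewrite ?subnn ?take0 ?cats0 ?drop_size ?cats0 // cat_take_drop.
  move: eqy; rewrite dq -!catA => /eqP; rewrite eqseq_cat // eqxx /= => /eqP eqy.
  (* t is read between the two reset positions, so that u t = q u. *)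
  pose t := take (size q) (v ++ y2).
  have ut : u ++ t = q ++ u.
    have := congr1 (take (size u + size q)) eqy.
    rewrite take_cat ltnNge leq_addr /= addKn => ->.
    by rewrite catA take_size_cat // size_cat addnC.
  have vy : v ++ y2 = t ++ v ++ y2'.
    have := congr1 (drop (size u)) eqy.
    by rewrite drop_size_cat // [q ++ _]catA -ut -catA drop_size_cat.
  rewrite vy run_cat (run_between (t := t)) //.
  - rewrite catA ut -catA; have := factor_r Ly; rewrite eqy => Lq.
    by apply: (@factor_l _ y2'); rewrite -!catA.
  - apply: (@prefix_of_prefix _ _ _ (u ++ v ++ y2)); first by rewrite catA prefix_prefix.
      by have := prefix_prefix (u ++ t ++ v) y2'; rewrite -!catA vy.
    by rewrite !size_cat; lia.
  by rewrite catA ut -catA suffix_suffix.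
move=> Ly [y1 [y2 [dy ->]]] [y1' [y2' [dy' ->]]].
case: (leqP (size y1) (size y1')) => [le|/ltnW le].
  by apply: (wl y1 y2 y1' y2') le; rewrite -?dy -?dy'.
by apply/esym; apply: (wl y1' y2' y1 y2) le; rewrite -?dy -?dy'.
Qed.

Lemma state_after_cat y x s : state_after y x -> state_after (y ++ s) (run x s).
Proof.
by case=> y1 [y2 [-> ->]]; exists y1, (y2 ++ s); rewrite -run_cat -!catA.
Qed.

Lemma state_after_catl y x s : state_after y x -> state_after (s ++ y) x.
Proof. by case=> y1 [y2 [-> ->]]; exists (s ++ y1), y2; rewrite -!catA. Qed.

End States.
End Return.

(** * States of the letters of a connected language *)

Section RecurrentLanguage.
Variables (A : finType) (L : set (seq A)).
Hypothesis L_rec : recurrent L.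
Let L_fact : forall u v, infix u v -> L v -> L u := L_rec.1.

Lemma ext_left z : L z -> exists a, L (a :: z).
Proof.
move=> Lz; have [w [w0 Lw]] := L_rec.2 _ _ Lz Lz.
move: w0 Lw; case/lastP: w => // w a _; rewrite cat_rcons => Lw.
by exists a; apply: L_fact Lw; rewrite catA suffix_infix // suffix_suffix.
Qed.

(** By recurrence the graph on the letters with an edge from b to c for each
    word bc of L is strongly connected. *)
Lemma recurrent_ind (P : A -> Prop) a b0 : L [:: a] -> L [:: b0] -> P b0 ->
  (forall b c, L [:: b; c] -> P b -> P c) -> P a.
Proof.
move=> La Lb0 P0 step; have [w [_ Lw]] := L_rec.2 _ _ Lb0 La.
elim: w b0 {Lb0} P0 Lw => [|c w IH] b Pb /= Lw; first exact: step Lw Pb.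
apply: (IH c); last exact: (factor_r L_fact (x := [:: b])).
by apply: (step b) => //; apply: (factor_l L_fact (y := w ++ [:: a])).
Qed.

End RecurrentLanguage.

Section LetterStates.
Variables (A : finType) (L : set (seq A)).
Hypothesis L_unif : uniformly_recurrent L.
Hypothesis L_conn : connected_language L.
Let L_fact : forall u v, infix u v -> L v -> L u := L_unif.1.1.

Lemma ext_connected_ind m (P R : A -> Prop) : graph_connected (ext_graph L m) ->
  (forall a c, L (a :: rcons m c) -> P a <-> R c) ->
  forall a a', L (a :: m) -> L (a' :: m) -> P a -> P a'.
Proof.
move=> conn PR a a' La La' Pa.
have Va : inl a \in ext_vertices L m by rewrite inE; apply/asboolP.
have Va' : inl a' \in ext_vertices L m by rewrite inE; apply/asboolP.
pose va : ext_graph L m := exist (fun x => x \in ext_vertices L m) _ Va.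
pose va' : ext_graph L m := exist (fun x => x \in ext_vertices L m) _ Va'.
have /connectP[p] := conn va va'.
pose S (x : A + A) := match x with inl a => P a | inr c => R c end.
have : S (val va) by [].
elim: p va => [x Sx _ /(congr1 val) /= xE|y p IH x Sx /= /andP[exy py]].
  by move: Sx; rewrite -[val x]/(sval x) -xE.
apply: IH py => //; move: exy Sx; rewrite /ext_edge /S.
by case: (val x) (val y) => [b|b] [c|c] // /asboolP /PR[].
Qed.

Section States.
Variables (u v : seq A) (X : Type) (act : A -> X -> X) (x0 : X).
Hypothesis Luv : L (u ++ v).
Hypothesis act_inj : forall c, injective (act c).
Hypothesis ret_fix : forall r, return_set L u v r -> run act x0 r = x0.
Local Notation state := (state_after u v act x0).
Let state_after_uniq := state_after_uniq L_fact ret_fix.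

Lemma state_after_ex z : L z -> exists y x, L (y ++ z) /\ state y x.
Proof.
move=> Lz; have [w [_ Lw]] := L_unif.1.2 _ _ Luv Lz.
exists (u ++ v ++ w); eexists; split; first by rewrite -!catA in Lw *; exact: Lw.
by exists [::], w.
Qed.

Definition state_determined_by_last n := forall m y y' x x',
  size m = n -> L (y ++ m) -> L (y' ++ m) ->
  state (y ++ m) x -> state (y' ++ m) x' -> x = x'.

Lemma state_determined_large : exists n, state_determined_by_last n.+1.
Proof.
have [N hN] := L_unif.2 _ Luv; exists N => m y y' x x' sm Ly Ly' gx gx'.
have Lm := factor_r L_fact Ly.
have /infixP[p [s mE]] := hN _ Lm (ltac:(lia)).
have gm : state m (run act x0 (v ++ s)) by exists p, s; rewrite mE -!catA.
rewrite (state_after_uniq Ly gx (state_after_catl y gm)).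
exact: state_after_uniq Ly' (state_after_catl y' gm) gx'.
Qed.

(** Let b m c be in L with m of length n + 1. Reading c after b m gives a state
    that only depends on m c, which has length n + 2; as c acts injectively, the
    state after b m does not change when b moves along an edge of the extension
    graph of m. That graph is connected, so the state depends on m only. *)
Lemma state_determined_pred n : state_determined_by_last n.+2 -> state_determined_by_last n.+1.
Proof.
move=> deep m y y' x x' sm Ly Ly' gx gx'.
have m0 : m != [::] by case: m sm {Ly Ly' gx gx'}.
have conn := L_conn (factor_r L_fact Ly) m0.
have left z t : L (z ++ m) -> state (z ++ m) t ->
    exists z' a, L (z' ++ a :: m) /\ state (z' ++ a :: m) t.
  move=> /(ext_left L_unif.1)[a La] /(state_after_catl [:: a]) ga; move: La ga.
  rewrite -[a :: _]/((a :: z) ++ m) -[[:: a] ++ _]/((a :: z) ++ m).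
  by rewrite lastI cat_rcons => La ga; exists (belast a z), (last a z).
have [z [a [La ga]]] := left _ _ Ly gx.
have [z' [a' [La' ga']]] := left _ _ Ly' gx'.
(* P and R propagate the equality with x to all the left and right vertices of
   the extension graph of m. *)
pose P b := forall y x', L (y ++ b :: m) -> state (y ++ b :: m) x' -> x = x'.
pose R c := forall y x', L (y ++ rcons m c) -> state (y ++ m) x' -> x = x'.
suff : P a' by move/(_ z' x' La' ga').
apply: (@ext_connected_ind m P R conn _ a); last first.
- by move=> w t Lw gw; apply: deep La Lw ga gw; rewrite /= sm.
- exact: factor_r La'.
- exact: factor_r La.
move=> b c Lbc; have [w [t [Lw gw]]] := state_after_ex Lbc.
have gb := state_after_cat (b :: m) gw; set t1 := run _ _ _ in gb.
have Lwb : L (w ++ b :: m) by move: Lw; rewrite -rcons_cons -cats1 catA => /(factor_l L_fact).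
have gbc := state_after_cat [:: c] gb; split=> [Pb y1 x1 Ly1 g1|Rc y1 x1 Ly1 g1].
  rewrite (Pb _ _ Lwb gb); apply: (@act_inj c).
  apply: (@deep (rcons m c) (w ++ [:: b]) y1) => //; first by rewrite size_rcons sm.
  - by rewrite -catA.
  - by move: gbc; rewrite -catA -cats1 -!catA.
  by have := state_after_cat [:: c] g1; rewrite -catA cats1.
have -> : x = t1.
  by apply: (Rc (w ++ [:: b])); rewrite -catA.
by apply: (@deep (b :: m) w y1) => //=; rewrite sm.
Qed.

(** Descent from a length at which every word of L contains u v. On a letter, the
    state does not depend on the past; hence an action of the letters for which
    the return words fix x0 lifts to the graph on the letters whose edges are the
    words of length 2 of L. *)
Lemma letter_states :
  exists g : A -> X, (forall b c, L [:: b; c] -> g c = act c (g b)) /\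
    (forall e, L (e :: u ++ v) -> g (last e u) = x0).
Proof.
have d1 : state_determined_by_last 1.
  have [n] := state_determined_large; elim: n => // n IH /state_determined_pred; exact: IH.
have gex a : exists x, forall y x', L (y ++ [:: a]) -> state (y ++ [:: a]) x' -> x' = x.
  have [La|nLa] := pselect (L [:: a]); last first.
    by exists x0 => y x' /(factor_r L_fact).
  have [y [x [Ly gy]]] := state_after_ex La; exists (act a x) => y' x' Ly' gx'.
  by apply: d1 Ly' Ly gx' _ => //; apply: (state_after_cat [:: a] gy).
have [g gP] := boolp.choice gex; exists g; split=> [b c Lbc|e Le].
  have [y [x [Ly gy]]] := state_after_ex Lbc.
  have Lyb : L (y ++ [:: b]).
    by move: Ly; rewrite -[[:: b; c]]/([:: b] ++ [:: c]) catA => /(factor_l L_fact).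
  have gb := state_after_cat [:: b] gy; have gc := state_after_cat [:: c] gb.
  rewrite -(gP _ _ _ Lyb gb) /=; apply/esym/(gP _ (y ++ [:: b])) => //.
  by rewrite -catA.
have [y [x [Ly gy]]] := state_after_ex Le.
have Lye : L (y ++ e :: u) by move: Ly; rewrite -cat_cons catA => /(factor_l L_fact).
have ge := state_after_cat (e :: u) gy; set x1 := run _ _ _ in ge.
have <- : x1 = g (last e u).
  by move: Lye ge; rewrite lastI -cats1 catA; apply: gP.
apply: (run_inj act_inj (s := v)).
apply: (state_after_uniq Ly).
  by have := state_after_cat v ge; rewrite -catA.
by exists (y ++ [:: e]), [::]; rewrite !cats0 -catA.
Qed.

End States.
End LetterStates.

(** * Neutrality and the number of return words *)

Section ExtCount.
Variables (A : finType) (L : set (seq A)).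
Hypothesis L_fact : forall u v, infix u v -> L v -> L u.
Local Notation l z := (`[< L z >]).

Definition nrightext z := #|[set c | l (rcons z c)]%SET|.
Definition nleftext z := #|[set a | l (a :: z)]%SET|.
Definition nbiext z := #|[set p : A * A | l (p.1 :: rcons z p.2)]%SET|.

Lemma card_ext_graph z : #|ext_graph L z| = (nleftext z + nrightext z)%N.
Proof.
rewrite card_sig -sum1_card big_sumType /= /nleftext /nrightext -!sum1_card.
by congr (_ + _)%N; apply: eq_bigl => a; rewrite !inE.
Qed.

(** Each edge is listed once when it is oriented from left to right. *)
Lemma card_ext_edges z : #|edge_set (ext_graph L z)| = nbiext z.
Proof.
pose V := ext_graph L z.
pose letter (x : A + A) : A := match x with inl a => a | inr b => b end.
pose is_l (x : A + A) := if x is inl _ then true else false.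
pose D := [set p : V * V | sedge p.1 p.2 & is_l (val p.1)]%SET.
have DP (p : V * V) : p \in D -> exists a b,
    [/\ val p.1 = inl a, val p.2 = inr b & L (a :: rcons z b)].
  case: p => -[[a|a] Va] [[b|b] Vb]; rewrite inE //= /ext_edge /= ?andbF //.
  by rewrite andbT => /asboolP Lab; exists a, b.
transitivity #|D|; last first.
  pose f (p : V * V) := (letter (val p.1), letter (val p.2)).
  rewrite -(@card_in_imset _ _ f) => [|p q pD qD]; last first.
    have [a [b [pa pb _]]] := DP _ pD; have [c [d [qc qd _]]] := DP _ qD.
    rewrite /f pa pb qc qd /= => -[ac bd]; rewrite [p]surjective_pairing [q]surjective_pairing.
    by congr pair; apply: val_inj; rewrite ?pa ?qc ?pb ?qd ?ac ?bd.
  apply: fintype.eq_card => -[a b]; rewrite !inE; apply/imsetP/asboolP => [[p pD]|Lab].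
    have [c [d [pc pd Lcd]]] := DP _ pD.
    by rewrite /f pc pd /= => -[-> ->].
  have Va : inl a \in ext_vertices L z.
    by rewrite inE; apply/asboolP; move: Lab; rewrite -rcons_cons -cats1 => /(factor_l L_fact).
  have Vb : inr b \in ext_vertices L z.
    by rewrite inE; apply/asboolP; move: Lab; rewrite -cat1s => /(factor_r L_fact).
  exists (exist (fun x => x \in ext_vertices L z) _ Va,
          exist (fun x => x \in ext_vertices L z) _ Vb) => //.
  by rewrite inE /= andbT /ext_edge /=; apply/asboolP.
rewrite -(@card_in_imset _ _ (fun p : V * V => [set p.1; p.2]%SET)) => [|p q pD qD eqs]; last first.
  have [a [b [pa pb _]]] := DP _ pD; have [c [d [qc qd _]]] := DP _ qD.
  have : p.1 \in [set q.1; q.2]%SET by rewrite -eqs set21.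
  have : p.2 \in [set q.1; q.2]%SET by rewrite -eqs set22.
  rewrite !inE -!(inj_eq val_inj) pa pb qc qd orbF /= => /eqP bd /eqP ac.
  rewrite [p]surjective_pairing [q]surjective_pairing.
  by congr pair; apply: val_inj; rewrite ?pa ?qc ?pb ?qd ?ac ?bd.
apply: fintype.eq_card => E; apply/imsetP/imsetP => -[p pD ->]; last first.
  by exists p => //; move: pD; rewrite !inE => /andP[].
have : (p \in D) || ((p.2, p.1) \in D).
  move: pD; rewrite !inE; case: p => -[[a|a] Va] [[b|b] Vb] /=;
    by rewrite /ext_edge //= => ->; rewrite ?orbT.
case/orP=> [pD'|pD']; first by exists p.
by exists (p.2, p.1) => //=; rewrite finset.setUC.
Qed.

Lemma nbiext_sum z : nbiext z = \sum_(a | l (a :: z)) nrightext (a :: z).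
Proof.
rewrite /nbiext -sum1_card.
under eq_bigl => p do rewrite inE.
rewrite (eq_bigl (fun p : A * A => l (p.1 :: z) && l (p.1 :: rcons z p.2))); last first.
  move=> p; apply/idP/andP => [/[dup] /asboolP Lp -> |[]//]; split=> //.
  by apply/asboolP; move: Lp; rewrite -rcons_cons -cats1 => /(factor_l L_fact).
rewrite -(pair_big_dep (fun a => l (a :: z)) (fun a c => l (a :: rcons z c)) (fun _ _ => 1%N)) /=.
by apply: eq_bigr => a _; rewrite /nrightext -sum1_card; apply: eq_bigl => c; rewrite inE.
Qed.

Local Open Scope ring_scope.
Import GRing.Theory.

(** Neutrality makes the excess additive over left extensions, like the measure
    of a cylinder set of left-infinite words. *)
Definition excess z : int := (nrightext z)%:R - 1.

Lemma neutral_excess z : neutral_word L z ->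
  \sum_(a | l (a :: z)) excess (a :: z) = excess z.
Proof.
rewrite /neutral_word /euler_char card_ext_graph card_ext_edges nbiext_sum => neu.
rewrite /excess sumrB -natr_sum sumr_const !natz.
have -> : #|[pred a | l (a :: z)]| = nleftext z by apply: fintype.eq_card => a; rewrite !inE.
by lia.
Qed.

End ExtCount.

Section CountReturns.
Variables (A : finType) (L : set (seq A)).
Hypothesis L_unif : uniformly_recurrent L.
Hypothesis L_neut : neutral_language L.
Hypothesis L_letters : forall a, L [:: a].
Let L_fact : forall u v, infix u v -> L v -> L u := L_unif.1.1.
Local Notation l z := (`[< L z >]).

Lemma bounded_enum n (P : pred (seq A)) : (forall z, P z -> (size z <= n)%N) ->
  exists s : seq (seq A), uniq s /\ forall z, (z \in s) = P z.
Proof.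
move=> bd; exists [seq z <- [seq val t | t <- enum {: n.-bseq A}] | P z]; split.
  by rewrite filter_uniq // map_inj_uniq ?enum_uniq //; apply: val_inj.
move=> z; rewrite mem_filter; apply/andP/idP => [[]//|Pz]; split=> //.
by apply/mapP; exists (Bseq (bd z Pz)); rewrite ?mem_enum.
Qed.

Import GRing.Theory.
Variable w : seq A.
Hypothesis Lw : L w.
Hypothesis w0 : w != [::].

(** The words avoiding w, extended to the left letter by letter, stop avoiding w
    at a word of starting; the words of starting, extended to the right, stop
    being starting at a first return to w. *)
Definition avoiding (z : seq A) := l z && ~~ infix w z.
Definition starting (z : seq A) := [&& l z, prefix w z & ~~ infix w (behead z)].

Lemma infix_dropP z : reflect (exists i, prefix w (drop i z)) (infix w z).
Proof.
refine (iffP (@infixP _ w z) _ _) => [[s [t ->]]|[i /prefixP[t dz]]].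
  by exists (size s); rewrite drop_size_cat // prefix_prefix.
by exists (take i z), t; rewrite -dz cat_take_drop.
Qed.

Lemma first_return_rcons z c :
  first_return L w (rcons z c) <-> [/\ L (rcons z c), starting z & infix w (behead (rcons z c))].
Proof.
have sw : (0 < size w)%N by rewrite lt0n size_eq0.
split=> [[Lz pz sz lt no]|[Lz /and3P[_ pz nz] iz]].
  have le : (size w <= size z)%N by rewrite size_rcons ltnS in lt.
  have pz' : prefix w z.
    by apply: prefix_of_prefix pz _ le; rewrite -cats1 prefix_prefix.
  have z0 : (0 < size z)%N by lia.
  split=> //.
    apply/and3P; split=> //.
      by apply/asboolP; move: Lz; rewrite -cats1 => /(factor_l L_fact).
    apply/infix_dropP => -[i]; rewrite -drop1 drop_drop => /[dup] /size_prefix; rewrite size_drop.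
    move=> /= lei /prefixP[t dz].
    have il : (0 < i + 1 < size (rcons z c) - size w)%N by rewrite size_rcons; lia.
    have := no _ il; rewrite drop_rcons; last by lia.
    by rewrite dz rcons_cat prefix_prefix.
  case: z z0 {pz pz' no} Lz sz lt le => //= a z _ Lz sz lt le.
  rewrite suffixW //; apply: (suffix_of_suffix sz); last by rewrite size_rcons.
  exact: (suffix_suffix [:: a]).
have /= le := size_prefix pz; have z0 : (0 < size z)%N by lia.
have sz : suffix w (rcons z c).
  case: z z0 nz iz {pz Lz le} => //= a z _ nz; rewrite infix_rconsl (negbTE nz) orbF.
  move/suffix_trans; apply; exact: (suffix_suffix [:: a]).
split=> //.
- by apply: (prefix_trans pz); rewrite -cats1 prefix_prefix.
- by rewrite size_rcons; lia.
move=> i; rewrite size_rcons => i_lt; apply: contra nz.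
rewrite drop_rcons; last by lia.
move=> pi; apply/infix_dropP; exists i.-1; rewrite -drop1 drop_drop addn1 prednK; last by lia.
apply: prefix_of_prefix pi _ _; first by rewrite -cats1 prefix_prefix.
by rewrite size_drop /=; lia.
Qed.

Lemma enum_avoiding : exists s : seq (seq A), uniq s /\ forall z, (z \in s) = avoiding z.
Proof.
have [N hN] := L_unif.2 _ Lw; apply: (@bounded_enum N) => z /andP[/asboolP Lz]; apply: contraNT.
by rewrite -ltnNge => /ltnW; apply: hN.
Qed.

Lemma enum_starting : exists s : seq (seq A), uniq s /\ forall z, (z \in s) = starting z.
Proof.
have [N hN] := L_unif.2 _ Lw; apply: (@bounded_enum N) => z /and3P[/asboolP Lz _]; apply: contraNT.
rewrite -ltnNge; case: z Lz => // a z Lz zN.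
by apply: hN => //; apply: (factor_r L_fact (x := [:: a])).
Qed.

Lemma enum_first_return : exists s : seq (seq A),
  uniq s /\ forall z, (z \in s) = `[< first_return L w z >].
Proof.
have [s [_ sP]] := enum_starting.
apply: (@bounded_enum (\max_(z <- s) size z).+1) => z; case/lastP: z => // z c /asboolP.
case/first_return_rcons => _ sz _; rewrite size_rcons ltnS.
by apply: (leq_bigmax_seq (F := size)) => //; rewrite sP.
Qed.

Section Sums.
Variables (I S C : seq (seq A)).
Hypotheses (uI : uniq I) (uS : uniq S) (uC : uniq C).
Hypotheses (IP : forall z, (z \in I) = avoiding z) (SP : forall z, (z \in S) = starting z)
  (CP : forall z, (z \in C) = `[< first_return L w z >]).

(** The left extensions of the words avoiding w are the nonempty words avoiding
    w and the words of starting. *)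
Lemma sum_left_ext (F : seq A -> int) :
  (\sum_(z <- I) \sum_(a | l (a :: z)) F (a :: z) =
  \sum_(z <- I | z != [::]) F z + \sum_(z <- S) F z)%R.
Proof.
pose E := [seq y <- [seq a :: z | z <- I, a <- enum A] | l y].
transitivity (\sum_(y <- E) F y)%R.
  rewrite big_filter [RHS]big_mkcond big_allpairs_dep /=; apply: eq_bigr => z _.
  by rewrite big_mkcond big_enum.
rewrite -(big_filter I) -big_cat; apply: perm_big; apply: uniq_perm.
- rewrite filter_uniq // allpairs_uniq ?enum_uniq //.
  by move=> [z a] [z' a'] _ _ /= [-> ->].
- rewrite cat_uniq filter_uniq // uS andbT /=; apply/hasPn => z.
  rewrite SP mem_filter IP => /and3P[_ pz _]; rewrite negb_and negbK negb_and negbK.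
  by rewrite prefixW ?orbT.
move=> y; rewrite mem_cat mem_filter mem_filter IP SP /avoiding /starting.
case: y => [|a y].
  transitivity false; last by case: (w) w0 => [//|b t] _; rewrite !andbF.
  by apply/negbTE; rewrite negb_and; apply/orP; right; apply/allpairsP => -[[z a] [_ _ eqz]].
rewrite infix_consl; have -> : (a :: y \in [seq a0 :: z | z <- I, a0 <- enum A]) = (y \in I).
  apply/allpairsP/idP => [[[z b] /= [zI _ [_ ->]]]//|yI].
  by exists (y, a); rewrite mem_enum.
rewrite IP /avoiding -[behead (a :: y)]/y; case: asboolP => [Lay|//]; rewrite !andTb.
have -> : l y by apply/asboolP; apply: (factor_r L_fact (x := [:: a])).
by rewrite negb_or; case: (prefix w _); case: (infix w y).
Qed.

(** The right extensions of the words of starting are the words of starting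
    other than w itself and the first returns. *)
Lemma sum_right_ext : (\sum_(z <- S) nrightext L z + 1 = size S + size C)%N.
Proof.
pose E := [seq y <- [seq rcons z c | z <- S, c <- enum A] | l y].
have -> : (\sum_(z <- S) nrightext L z = size E)%N.
  rewrite -sum1_size big_filter [RHS]big_mkcond big_allpairs_dep /=; apply: eq_bigr => z _.
  rewrite /nrightext -sum1_card big_mkcond [RHS]big_enum /=; apply: eq_bigr => c _; by rewrite inE.
have wS : w \in S.
  rewrite SP /starting prefix_refl /=; apply/andP; split; first exact/asboolP.
  by apply/negP => /size_infix; case: (w) w0 => //= a t _; rewrite ltnn.
suff /perm_size -> : perm_eq E (rem w S ++ C).
  by rewrite size_cat size_rem //; case: (S) wS => //= *; lia.
apply: uniq_perm.
- rewrite filter_uniq // allpairs_uniq ?enum_uniq //.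
  by move=> [z a] [z' a'] _ _ /= /rcons_inj[-> ->].
- rewrite cat_uniq rem_uniq // uC andbT /=; apply/hasPn => z; rewrite CP => /asboolP.
  case/lastP: z => [[_ _ _]//|z c /first_return_rcons[_ _ iz]].
  by rewrite mem_rem_uniq // inE SP /starting iz !andbF.
move=> y; rewrite mem_cat mem_filter mem_rem_uniq // inE SP CP /starting.
case/lastP: y => [|y c].
  transitivity false.
    apply/negbTE; rewrite negb_and; apply/orP; right; apply/allpairsP => -[[z c] /= [_ _]].
    by case: z.
  apply/esym/negbTE; rewrite negb_or; apply/andP; split; last by apply/asboolP => -[].
  by case: (w) w0 => [//|a t] _; rewrite !andbF.
have -> : (rcons y c \in [seq rcons z a0 | z <- S, a0 <- enum A]) = (y \in S).
  apply/allpairsP/idP => [[[z b] /= [zI _ /rcons_inj[-> _]]]//|yI].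
  by exists (y, c); rewrite mem_enum.
rewrite SP; apply/andP/orP => [[/asboolP Ly sy]|[|]].
- have /and3P[_ py ny] := sy.
  have [iy|niy] := boolP (infix w (behead (rcons y c))).
    by right; apply/asboolP/first_return_rcons.
  left; apply/and4P; split=> //; last 1 first.
  + by apply: (prefix_trans py); rewrite -cats1 prefix_prefix.
  + by apply: contraTneq (size_prefix py) => <-; rewrite size_rcons ltnn.
  exact/asboolP.
- case/and4P=> yw /asboolP Ly py ny; split; first exact/asboolP.
  have py' : prefix w y.
    apply: (prefix_of_prefix py); first by rewrite -cats1 prefix_prefix.
    rewrite -ltnS -(size_rcons y c) ltn_neqAle (size_prefix py) andbT.
    apply: contra yw => /eqP eqs; move: py; rewrite prefixE eqs take_size => /eqP->.
    exact: eqxx.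
  apply/and3P; split=> //.
    by apply/asboolP; move: Ly; rewrite -cats1 => /(factor_l L_fact).
  apply: contra ny; case: y py' {yw Ly py} => [|a y] pw /=.
    by case: (w) w0 pw.
  by rewrite infix_rconsl orbC => ->.
by move/asboolP/first_return_rcons=> [Ly sy _]; split; first exact/asboolP.
Qed.

(** Every long word of L has exactly one suffix in starting, so by additivity
    the excess of starting is the excess of the set of letters. On the other
    hand, counting right extensions shows that it is the number of first returns
    minus 1. *)
Lemma size_first_returns : (size C + #|A| = 1 + nbiext L [::])%N.
Proof.
have Lnil : L [::] by apply: (L_fact (infix0s w)).
have nilI : [::] \in I.
  by rewrite IP /avoiding infixs0 w0 andbT; apply/asboolP.
have E1 : (\sum_(z <- I | z != [::]) \sum_(a | l (a :: z)) excess L (a :: z) =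
           \sum_(z <- I | z != [::]) excess L z)%R.
  rewrite big_seq_cond [RHS]big_seq_cond; apply: eq_bigr => z.
  rewrite IP => /andP[/andP[/asboolP Lz _] z0].
  by apply: neutral_excess => //; apply: L_neut.
have := sum_left_ext (excess L); rewrite (bigD1_seq [::]) //= {}E1 addrC.
move/addrI; have -> : (\sum_(a | l [:: a]) excess L [:: a] = (nbiext L [::])%:R - #|A|%:R)%R.
  have lT a : l [:: a] = predT a by apply/asboolP.
  rewrite nbiext_sum // !(eq_bigl predT _ lT).
  by rewrite sumrB -natr_sum sumr_const.
rewrite /excess sumrB -natr_sum big_const_seq count_predT iter_addr addr0; have := sum_right_ext.
rewrite !natz => /= h1 h2; lia.
Qed.
End Sums.
End CountReturns.

(** * Restricting homomorphisms to a return set *)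

Section Restriction.
Variables (A : finType) (L : set (seq A)).
Hypothesis L_unif : uniformly_recurrent L.
Hypothesis L_conn : connected_language L.
Hypothesis L_neut : neutral_language L.
Hypothesis L_letters : forall a, L [:: a].
Let L_fact : forall u v, infix u v -> L v -> L u := L_unif.1.1.
Local Notation l z := (`[< L z >]).
Local Notation V0 := (ext_graph L [::]).

Lemma enum_return_set u v : L (u ++ v) -> u ++ v != [::] ->
  exists s : seq (seq A), [/\ uniq s, (forall r, (r \in s) = `[< return_set L u v r >]) &
    (size s + #|A| = 1 + nbiext L [::])%N].
Proof.
move=> Lw w0.
have [I [uI IP]] := enum_avoiding L_unif Lw.
have [S [uS SP]] := enum_starting L_unif Lw.
have [C [uC CP]] := enum_first_return L_unif Lw w0.
have sC := size_first_returns L_unif L_neut L_letters Lw w0 uI uS uC IP SP CP.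
pose mid (z : seq A) := take (size z - size (u ++ v)) (drop (size u) z).
have midK r : mid (u ++ r ++ v) = r.
  rewrite /mid drop_size_cat // take_size_cat // !size_cat; lia.
have midP z : first_return L (u ++ v) z -> z = u ++ mid z ++ v.
  case=> _ /prefixP[t zE] sz lt _.
  have du : drop (size u) z = v ++ t by rewrite zE -catA drop_size_cat.
  have : suffix v (drop (size u) z).
    apply: (@suffix_of_suffix _ _ _ z).
    - by apply: suffix_trans sz; apply: suffix_suffix.
    - by rewrite -{2}(cat_take_drop (size u) z) suffix_suffix.
    by rewrite du size_cat leq_addr.
  case/suffixP => q dq; rewrite {1}zE -catA; congr (u ++ _).
  rewrite /mid du -du dq take_size_cat //.
  have := congr1 size dq; rewrite size_drop !size_cat => /= h; lia.
exists [seq mid z | z <- C]; split; last by rewrite size_map.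
  rewrite map_inj_in_uniq // => y z; rewrite !CP => /asboolP/midP yE /asboolP/midP zE eqm.
  by rewrite yE zE eqm.
move=> r; apply/mapP/asboolP => [[z + ->]|/(return_setE L_fact) fr].
  rewrite CP => /asboolP fr; apply/(return_setE L_fact); by rewrite -midP.
by exists (u ++ r ++ v); rewrite ?CP //; apply/asboolP.
Qed.

Lemma left_neighbour_ex (c : A) : exists b, L [:: b; c].
Proof. exact: (ext_left L_unif.1 (L_letters c)). Qed.

Definition left_neighbour c := projT1 (cid (left_neighbour_ex c)).
Lemma left_neighbourP c : L [:: left_neighbour c; c].
Proof. exact: projT2 (cid (left_neighbour_ex c)). Qed.

(** Two letters are siblings when they have a common right neighbour, hence lie,
    as left vertices, in the same component of the extension graph of the empty
    word. *)
Definition siblings (b b' : A) := [exists c, l [:: b; c] && l [:: b'; c]].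
Lemma siblingsP b b' c : L [:: b; c] -> L [:: b'; c] -> siblings b b'.
Proof. by move=> h h'; apply/existsP; exists c; apply/andP; split; apply/asboolP. Qed.

(** Each right vertex c is joined to the left vertex of a left neighbour of c, so
    a function that is constant along the edges is determined by its values on
    the left vertices. *)
Lemma card_siblings_constant (Q : finType) (q0 : Q) :
  #|[set g : {ffun A -> Q} | edge_constant siblings g]%SET| =
  (#|Q| ^ n_comp (@sedge V0) V0)%N.
Proof.
rewrite -(card_edge_constant q0 (@sedge_connect_sym V0)).
have Vl b : inl b \in ext_vertices L [::] by rewrite inE; apply/asboolP/L_letters.
pose vl b : V0 := exist (fun x => x \in ext_vertices L [::]) _ (Vl b).
have Vr b : inr b \in ext_vertices L [::] by rewrite inE; apply/asboolP/L_letters.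
pose vr b : V0 := exist (fun x => x \in ext_vertices L [::]) _ (Vr b).
have lr b c : sedge (vl b) (vr c) = l [:: b; c] by [].
have vlr (x : V0) : (exists b, x = vl b) \/ (exists b, x = vr b).
  by case: x => -[b|b] Vb; [left|right]; exists b; apply: val_inj.
pose res (h : {ffun V0 -> Q}) := [ffun b => h (vl b)].
rewrite -(@card_in_imset _ _ res) => [|h h']; last first.
  rewrite !inE => /edge_constantP hc /edge_constantP hc' /ffunP eqr.
  apply/ffunP => x; case: (vlr x) => -[b ->]; first by have := eqr b; rewrite !ffunE.
  have e1 : sedge (vl (left_neighbour b)) (vr b) by rewrite lr; apply/asboolP/left_neighbourP.
  by have := eqr (left_neighbour b); rewrite !ffunE (hc _ _ e1) (hc' _ _ e1).
apply: fintype.eq_card => g; rewrite inE; apply/edge_constantP/imsetP => [gc|[h]].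
  pose h : {ffun V0 -> Q} :=
    [ffun x : V0 => match val x with inl b => g b | inr c => g (left_neighbour c) end].
  exists h; last by apply/ffunP => b; rewrite !ffunE.
  rewrite inE; apply/edge_constantP => x y; rewrite !ffunE.
  by case: (vlr x) (vlr y) => -[b ->] [] [c ->] //= /asboolP Lbc;
    [|apply/esym]; apply: gc; apply: siblingsP Lbc (left_neighbourP _).
rewrite inE => /edge_constantP hc -> b b' /existsP[c /andP[bc bc']].
by rewrite !ffunE (hc _ (vr c)) // -?(hc (vl b')).
Qed.

Section Telescope.
Local Open Scope group_scope.
Variables (G : groupType) (f g : A -> G).
Hypothesis gc : forall b b', siblings b b' -> g b = g b'.
(** The gauge transform of f by g. *)
Definition twist c := (g (left_neighbour c))^-1 * f c * g c.

Lemma twistE b c : L [:: b; c] -> twist c = (g b)^-1 * f c * g c.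
Proof. by move=> Lbc; rewrite /twist (gc (siblingsP (left_neighbourP c) Lbc)). Qed.

Lemma prod_twist b r : L (b :: r) ->
  \prod_(c <- r) twist c = (g b)^-1 * (\prod_(c <- r) f c) * g (last b r).
Proof.
elim: r b => [|c r IH] b Lr; first by rewrite !big_nil mulg1 mulVg.
have Lbc : L [:: b; c] by apply: (factor_l L_fact (y := r)).
rewrite !big_cons (IH c); last exact: (factor_r L_fact (x := [:: b])).
by rewrite (twistE Lbc) /= !mulgA mulgK.
Qed.
End Telescope.

Section Pair.
Variables u v : seq A.
Hypothesis Luv : L (u ++ v).
(** In u r v, preceded by a letter e, the return word r is read from the letter
    before it to its own last letter (or to the former, if r is empty), and both
    of these are the letter before v in a word e u v of L. *)
Lemma return_path r : return_set L u v r -> exists b, [/\ L (b :: r),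
  exists2 e, L (e :: u ++ v) & b = last e u &
  exists2 e, L (e :: u ++ v) & last b r = last e u].
Proof.
case=> _ Lz /prefixP[p pE] /suffixP[q qE] _; have [e Le] := ext_left L_unif.1 Lz.
have uq : u ++ r = q ++ u.
  have := congr1 size qE; rewrite !size_cat => sq.
  move: qE; rewrite !catA => /eqP; rewrite eqseq_cat; last by rewrite !size_cat; lia.
  by case/andP => /eqP.
exists (last e u); split.
- by apply: (@factor_mid _ _ L_fact (belast e u) _ v); rewrite cat_cons -cat_rcons -lastI.
- by exists e => //; apply: (factor_l L_fact (y := p)); rewrite cat_cons -pE.
exists (last e q); last by rewrite -last_cat uq last_cat.
apply: (factor_r L_fact (x := belast e q)).
by rewrite -cat_rcons -lastI cat_cons -qE.
Qed.

Hypothesis uv0 : u ++ v != [::].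

(** If u is not empty then both letters are the last letter of u; otherwise they
    both precede the first letter of v. *)
Lemma base_siblings (T : Type) (g : A -> T) : (forall b b', siblings b b' -> g b = g b') ->
  forall e e', L (e :: u ++ v) -> L (e' :: u ++ v) -> g (last e u) = g (last e' u).
Proof.
move=> gc e e'; case: u uv0 => [|//]; case: v => // c t _ /= Le Le'; apply: gc.
by apply: (@siblingsP _ _ c); apply: (factor_l L_fact (y := t)).
Qed.

Variable s : seq (seq A).
Hypothesis us : uniq s.
Hypothesis sP : forall r, (r \in s) = `[< return_set L u v r >].

Section Restrict.
Local Open Scope group_scope.
Variable Q : finGroupType.

Definition restrict (f : {ffun A -> Q}) : {ffun 'I_(size s) -> Q} :=
  [ffun i : 'I_(size s) => \prod_(a <- nth [::] s i) f a].

Lemma restrict_eqP (f f' : {ffun A -> Q}) : reflect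
  (forall r, return_set L u v r -> \prod_(a <- r) f a = \prod_(a <- r) f' a)
  (restrict f == restrict f').
Proof.
apply: (iffP eqP) => [/ffunP eqr r rr|eqr].
  have rs : r \in s by rewrite sP; apply/asboolP.
  have ilt : (index r s < size s)%N by rewrite index_mem.
  by have := eqr (Ordinal ilt); rewrite !ffunE /= nth_index.
apply/ffunP => i; rewrite !ffunE; apply: eqr.
by apply/asboolP; rewrite -sP mem_nth.
Qed.

Variables (e0 : A) (Le0 : L (e0 :: u ++ v)).
Let b0 := last e0 u.
(** The gauge transformations that are trivial at the base letter b0, which
    precedes a return word. *)
Definition based_gauges := [set g : {ffun A -> Q} | edge_constant siblings g && (g b0 == 1)]%SET.

(** Normalize a function that is constant on siblings by its value at b0. *)
Lemma card_based_gauges : (#|Q| * #|based_gauges| = #|Q| ^ n_comp (@sedge V0) V0)%N.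
Proof.
rewrite -(card_siblings_constant (1 : Q)) -cardsT -cardsX.
pose h (p : Q * {ffun A -> Q}) := [ffun b => p.1 * p.2 b].
rewrite -(@card_in_imset _ _ h) => [|[q g] [q' g']]; last first.
  rewrite !inE /= => /andP[_ /eqP g1] /andP[_ /eqP g1'] /ffunP eqh.
  have qq : q = q' by have := eqh b0; rewrite !ffunE /= g1 g1' !mulg1.
  congr pair => //; apply/ffunP => b; have := eqh b; rewrite !ffunE /= qq.
  exact: mulgI.
apply: fintype.eq_card => g; rewrite inE; apply/imsetP/edge_constantP => [[[q g']]|gc].
  rewrite !inE /= => /andP[/edge_constantP gc _] -> b b' bb'.
  by rewrite !ffunE /= (gc _ _ bb').
exists (g b0, [ffun b => (g b0)^-1 * g b]); last first.
  by apply/ffunP => b; rewrite !ffunE /= mulKVg.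
rewrite !inE /= ffunE mulVg eqxx andbT; apply/edge_constantP => b b' bb'.
by rewrite !ffunE (gc _ _ bb').
Qed.

(** If f and f' agree on the return words then 1 is fixed by the return words
    for the action x |-> (f c)^-1 x (f' c) of the letters, and the resulting
    states of the letters form the gauge transformation from f to f'. *)
Lemma card_restrict_fiber (f : {ffun A -> Q}) :
  #|[set f' | restrict f' == restrict f]%SET| = #|based_gauges|.
Proof.
pose tw (g : {ffun A -> Q}) := [ffun c => twist f g c].
rewrite -(@card_in_imset _ _ tw based_gauges) => [|g g']; last first.
  rewrite !inE => /andP[/edge_constantP gc /eqP g1] /andP[/edge_constantP gc' /eqP g1'] /ffunP eqt.
  apply/ffunP => a; apply: (recurrent_ind (P := fun a => g a = g' a) L_unif.1 (b0 := b0)) => //.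
    by rewrite g1.
  move=> b c Lbc eqb; have := eqt c; rewrite !ffunE !(twistE _ _ Lbc) // eqb.
  exact: mulgI.
apply: fintype.eq_card => f'; rewrite inE; apply/restrict_eqP/imsetP => [eqr|[g]].
  pose act c (x : Q) := (f c)^-1 * x * f' c.
  have actI c : injective (act c) by move=> x y /mulIg/mulgI.
  have runE x r : run act x r = (\prod_(a <- r) f a)^-1 * x * \prod_(a <- r) f' a.
    elim: r x => [|a r IH] x /=; first by rewrite !big_nil invg1 mul1g mulg1.
    by rewrite IH !big_cons /act invMg !mulgA.
  have [|g [gE g0]] := @letter_states _ _ L_unif L_conn u v _ act 1 Luv actI.
    by move=> r rr; rewrite runE eqr // mulg1 mulVg.
  have gc b b' : siblings b b' -> g b = g b'.
    case/existsP=> c /andP[/asboolP bc /asboolP bc'].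
    by apply: (actI c); rewrite -!gE.
  exists (finfun g).
    rewrite inE ffunE g0 // eqxx andbT; apply/edge_constantP => b b' bb'.
    by rewrite !ffunE; apply: gc.
  apply/ffunP => c; rewrite ffunE /twist !ffunE (gE _ _ (left_neighbourP c)) /act.
  by rewrite !mulgA mulgK mulVg mul1g.
rewrite inE => /andP[/edge_constantP gc /eqP g1] -> r /return_path[b [Lb [e Le be] [e' Le' be']]].
under eq_bigr => c _ do rewrite ffunE.
rewrite (prod_twist _ gc Lb) be' be (base_siblings gc Le Le0) (base_siblings gc Le' Le0).
by rewrite g1 invg1 mul1g mulg1.
Qed.

Lemma card_restrict :
  (#|Q| ^ (#|A|).+1 = #|[set restrict f | f : {ffun A -> Q}]%SET| * #|Q| ^ n_comp (@sedge V0) V0)%N.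
Proof.
rewrite expnS -card_ffun (card_const_fibers card_restrict_fiber) -card_based_gauges.
by rewrite mulnCA.
Qed.

Definition restrict_onto := forall gamma : {ffun 'I_(size s) -> Q}, exists f, restrict f = gamma.

Lemma restrict_onto_of_card : (#|A|.+1 = n_comp (@sedge V0) V0 + size s)%N -> restrict_onto.
Proof.
move=> cA gamma; suff : gamma \in [set restrict f | f : {ffun A -> Q}]%SET.
  by case/imsetP => f _ ->; exists f.
suff -> : [set restrict f | f : {ffun A -> Q}]%SET = finset.setT by rewrite inE.
apply/eqP; rewrite eqEcard finset.subsetT cardsT card_ffun card_ord.
have Q0 : (0 < #|Q|)%N by rewrite -cardsT cardG_gt0.
rewrite -(@leq_pmul2r (#|Q| ^ n_comp (@sedge V0) V0)) ?expn_gt0 ?Q0 //.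
by rewrite -card_restrict cA expnD mulnC leqnn.
Qed.

Lemma card_of_restrict_onto : (1 < #|Q|)%N -> restrict_onto ->
  (#|A|.+1 = n_comp (@sedge V0) V0 + size s)%N.
Proof.
move=> Q1 all; apply: (@expnI #|Q|) => //.
rewrite card_restrict expnD mulnC; congr (_ * _)%N.
rewrite -[in RHS](card_ord (size s)) -card_ffun -cardsT; apply: fintype.eq_card => gamma.
by rewrite [RHS]inE; have [f <-] := all gamma; rewrite imset_f.
Qed.

End Restrict.
End Pair.
End Restriction.

(** * Free return sets *)

Section Cosets.
Local Open Scope group_scope.
Local Open Scope classical_set_scope.

Definition coset_by (G : groupType) (H : set G) (p : G) : set G := [set x | H (x * p^-1)].

(** Representatives of the right cosets of H, with 1 for H itself. *)
Lemma coset_rep (G : groupType) (H : set G) : exists p : set G -> G,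
  (forall X, (exists q, X = coset_by H q) -> X = coset_by H (p X)) /\ p H = 1.
Proof.
have pex (X : set G) : exists p,
    ((exists q, X = coset_by H q) -> X = coset_by H p) /\ (X = H -> p = 1).
  have [->|XH] := pselect (X = H).
    by exists 1; split=> // _; apply/seteqP; split=> x; rewrite /coset_by /= invg1 mulg1.
  have [[q Xq]|no] := pselect (exists q, X = coset_by H q); last by exists 1.
  by exists q.
have [p pP] := boolp.choice pex; exists p; split=> [X|]; first exact: (pP X).1.
exact: (pP H).2.
Qed.
End Cosets.

Section Final.
Variables (A : finType) (L : set (seq A)).
Hypothesis L_unif : uniformly_recurrent L.
Hypothesis L_conn : connected_language L.
Hypothesis L_neut : neutral_language L.
Hypothesis L_letters : forall a, L [:: a].
Let L_fact : forall u v, infix u v -> L v -> L u := L_unif.1.1.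
Local Notation V0 := (ext_graph L [::]).
Local Open Scope group_scope.

Section Pair.
Variables u v : seq A.
Hypothesis Luv : L (u ++ v).
Hypothesis uv0 : u ++ v != [::].
Variable s : seq (seq A).
Hypothesis us : uniq s.
Hypothesis sP : forall r, (r \in s) = `[< return_set L u v r >].

Local Notation F := (free_group A).
Local Notation R := ((@word_fg A @` return_set L u v)%classic : set F).

Lemma free_of_restrict_onto : (forall Q : finGroupType, restrict_onto s Q) -> free_subset R.
Proof.
move=> ext; apply: free_subset_extend => X phi.
have Rs (i : 'I_(size s)) : word_fg (nth [::] s i) \in R.
  apply/mem_set; exists (nth [::] s i) => //.
  by apply/asboolP; rewrite -sP mem_nth.
have [f fE] := ext _ [ffun i => phi (SigSub (Rs i) : R)].
exists f => x; have [r rr rE] := set_mem (valP x).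
have [i ri] : exists i : 'I_(size s), nth [::] s i = r.
  have ilt : (index r s < size s)%N by rewrite index_mem sP; apply/asboolP.
  by exists (Ordinal ilt); rewrite nth_index // -index_mem.
have := congr1 (fun h : {ffun 'I_(size s) -> _} => h i) fE.
rewrite !ffunE -rE fg_lift_word -ri => ->; congr phi; apply: val_inj => /=.
by rewrite -rE ri.
Qed.

(** Let H be the subgroup generated by the return words. Applied to the
    translations of the cosets of H, letter_states yields representatives p with
    p(b) c p(c)^-1 in H for all the words bc of L. A map from the return set to
    Q extends to a homomorphism psi from H, by freeness; then
    c |-> psi (p(b) c p(c)^-1), with b a left neighbour of c, is the
    required map on letters, as the representatives cancel along a return
    word. *)
Lemma restrict_onto_of_free (Q : finGroupType) : free_subset R -> restrict_onto s Q.
Proof.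
move=> free gamma; pose H := gen_subgroup R.
pose act c (X : set F) : set F := [set x | X (x * (fg_gen c)^-1)]%classic.
have actI c : injective (act c).
  move=> X Y eqXY; apply/seteqP; split=> x xX.
    have : act c X (x * fg_gen c) by rewrite /act /= mulgK.
    by rewrite eqXY /act /= mulgK.
  have : act c Y (x * fg_gen c) by rewrite /act /= mulgK.
  by rewrite -eqXY /act /= mulgK.
have runE r X : run act X r = [set x | X (x * (word_fg r)^-1)]%classic.
  elim: r X => [|c r IH] X /=.
    by rewrite /word_fg big_nil; apply/seteqP; split=> x /=; rewrite invg1 mulg1.
  rewrite IH /word_fg big_cons /act; apply/seteqP; split=> x /=; by rewrite invMg mulgA.
have Hr r : return_set L u v r -> H (word_fg r).
  by move=> rr; apply: gen_subgroup_sub; exists r.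
have [|g [gE g0]] := @letter_states _ _ L_unif L_conn u v _ act H Luv actI.
  move=> r /Hr hr; rewrite runE; apply/seteqP; split=> x /= hx.
    by rewrite -[x](mulgKV (word_fg r)); apply: gen_subgroupM.
  by apply: gen_subgroupM hx _; apply: gen_subgroupV.
have [e0 Le0] := ext_left L_unif.1 Luv.
have gc b b' : siblings L b b' -> g b = g b'.
  case/existsP=> c /andP[/asboolP bc /asboolP bc'].
  by apply: (actI c); rewrite -!gE.
have [rep [repE rep1]] := coset_rep H.
have actC c q : act c (coset_by H q) = coset_by H (q * fg_gen c).
  by apply/seteqP; split=> x; rewrite /act /coset_by /= invMg mulgA.
have gcos a : exists q, g a = coset_by H q.
  apply: (recurrent_ind (P := fun a => exists q, g a = coset_by H q) L_unif.1
    (b0 := last e0 u)) => //.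
    exists 1; rewrite g0 //; apply/seteqP; split=> x; by rewrite /coset_by /= invg1 mulg1.
  by move=> b c Lbc [q gq]; exists (q * fg_gen c); rewrite (gE _ _ Lbc) gq actC.
pose p a := rep (g a).
have pE a : g a = coset_by H (p a) by apply: repE.
pose h c := twist L_unif L_letters (@fg_gen A) (fun a => (p a)^-1) c.
have hH c : H (h c).
  set b := left_neighbour L_unif L_letters c.
  have := gE _ _ (left_neighbourP L_unif L_letters c).
  rewrite pE [g (left_neighbour _ _ _)]pE actC => /seteqP[_ sub].
  have /sub : coset_by H (p b * fg_gen c) (p b * fg_gen c).
    by rewrite /coset_by /= mulgV; apply: gen_subgroup1.
  by rewrite /coset_by /= /h /twist invgK.
have hex c : exists x : free_group R, fg_lift (fun y : R => val y) x = h c.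
  have := hH c; rewrite /H -gen_subgroup_range => -[x _ <-]; by exists x.
have [x xE] := boolp.choice hex.
have phiex (y : R) : exists q : Q, forall i : 'I_(size s),
    val y = word_fg (nth [::] s i) -> gamma i = q.
  have [r rr rE] := set_mem (valP y).
  have ilt : (index r s < size s)%N by rewrite index_mem sP; apply/asboolP.
  exists (gamma (Ordinal ilt)) => i; rewrite -rE => /word_fg_inj rn; congr (gamma _).
  by apply: val_inj; rewrite /= rn index_uniq.
have [phi phiE] := boolp.choice phiex.
exists [ffun c => fg_lift phi (x c)]; apply/ffunP => i; rewrite ffunE.
set r := nth [::] s i; have rr : return_set L u v r by apply/asboolP; rewrite -sP mem_nth.
under eq_bigr => c _ do rewrite ffunE.
rewrite -(gmulf_prod (fg_lift phi)).
have rR : word_fg r \in R by apply/mem_set; exists r.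
suff -> : \prod_(c <- r) x c = fg_gen (SigSub rR : R).
  by rewrite [LHS](fg_lift_gen phi); apply/esym/phiE.
have /free_subsetP ker := free.
apply: (@gmulf_inj _ _ (fg_lift (fun y : R => val y))) => //.
rewrite gmulf_prod [RHS]fg_lift_gen /=.
under eq_bigr => c _ do rewrite [fg_lift _ _]xE.
have [b [Lb [e Le be] [e' Le' be']]] := return_path L_unif rr.
have pc b1 b2 : siblings L b1 b2 -> (p b1)^-1 = (p b2)^-1 by move/gc; rewrite /p => ->.
rewrite (prod_twist L_unif L_letters (@fg_gen A) pc Lb) /p be' be !g0 // rep1 !invg1 mul1g mulg1.
by [].
Qed.

End Pair.

(** The return words are the letters, and any map on the letters extends. *)
Lemma free_return_set_nil : free_return_set L [::] [::].
Proof.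
have rP r : return_set L [::] [::] r <-> exists a, r = [:: a].
  rewrite (return_setE L_fact) /= cats0; split=> [[Lr _ _ s0 no]|[a ->]].
    case: r s0 no {Lr} => [//|a [|b r]] _ no; first by exists a.
    by have := no 1%N isT; rewrite prefix0s.
  split=> //.
  by case=> [|[]].
apply: free_subset_extend => X phi.
have aR (a : A) : word_fg [:: a] \in (@word_fg A @` return_set L [::] [::])%classic.
  by apply/mem_set; exists [:: a] => //; apply/rP; exists a.
exists (fun a => phi (SigSub (aR a))) => x.
have [r /rP[a rE] xE] := set_mem (valP x).
rewrite -xE fg_lift_word rE big_seq1; congr phi; apply: val_inj => /=.
by rewrite -rE.
Qed.

Lemma card_V0 : #|V0| = (#|A| + #|A|)%N.
Proof.
rewrite card_ext_graph; congr (_ + _)%N; rewrite -cardsT; apply: fintype.eq_card => a;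
  by rewrite !inE; apply/asboolP/L_letters.
Qed.

(** Comparing the two counts: 2 |A| is the number of vertices of the extension
    graph of the empty word, c its number of components and e its number of
    edges; freeness of the return set R means that |A| + 1 = c + |R|, and
    |R| + |A| = 1 + e. *)
Lemma free_return_setP u v : L (u ++ v) -> u ++ v != [::] ->
  free_return_set L u v <-> forest V0.
Proof.
move=> Luv uv0; have [s [us sP sc]] := enum_return_set L_unif L_neut L_letters Luv uv0.
have [e0 Le0] := ext_left L_unif.1 Luv.
have cP : forest V0 <-> (#|A|.+1 = n_comp (@sedge V0) V0 + size s)%N.
  by rewrite forest_card (card_ext_edges L_fact) card_V0; split=> h; lia.
rewrite cP; split=> [free|cA].
  (* Any nontrivial finite group will do. *)
  apply: (card_of_restrict_onto L_unif L_conn L_letters Luv uv0 sP Le0 (Q := 'S_2)).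
    by rewrite card_Sn.
  exact: (restrict_onto_of_free Luv us sP).
refine (free_of_restrict_onto sP _) => Q.
exact: (restrict_onto_of_card L_unif L_conn L_letters Luv uv0 sP Le0).
Qed.

(** Connectedness gives c = 1 in forest_card, and neutrality gives the equation. *)
Lemma neutral_connected_forest w : L w -> w != [::] -> forest (ext_graph L w).
Proof.
move=> Lw w0; have conn := L_conn Lw w0; apply/forest_card.
have [a La] := ext_left L_unif.1 Lw.
have Va : inl a \in ext_vertices L w by rewrite inE; apply/asboolP.
pose va : ext_graph L w := exist (fun x => x \in ext_vertices L w) _ Va.
have -> : n_comp (@sedge (ext_graph L w)) (ext_graph L w) = 1%N.
  rewrite -(n_comp_connect (@sedge_connect_sym _) va); apply: eq_n_comp_r => x.
  by rewrite [RHS]conn.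
have := L_neut Lw w0; rewrite /neutral_word /euler_char.
lia.
Qed.

Lemma tree_setP : tree_set L <-> forest V0.
Proof.
split=> [[]//|fo]; split=> // w Lw w0; split; first exact: L_conn.
exact: neutral_connected_forest.
Qed.

End Final.

(* In (1) the pair of empty words is excluded: its return set is the set of
   letters, which is free whatever L is. *)
Theorem corollary1p3 (A : finType) (L : set (seq A))
    (A_nonempty : (0 < #|A|)%N)
    (L_unif_rec : uniformly_recurrent L)
    (A_sub_L : forall a : A, L [:: a])
    (L_connected : connected_language L)
    (L_neutral : neutral_language L) :
  ((exists u v : seq A, [/\ L (u ++ v), u ++ v <> [::] & free_return_set L u v])
   <-> (forall u v : seq A, L (u ++ v) -> free_return_set L u v))
  /\
  ((forall u v : seq A, L (u ++ v) -> free_return_set L u v) <-> tree_set L).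
Proof.
have retP := free_return_setP L_unif_rec L_connected L_neutral A_sub_L.
rewrite (tree_setP L_unif_rec L_connected L_neutral).
have all_free : forest (ext_graph L [::]) -> forall u v, L (u ++ v) -> free_return_set L u v.
  move=> fo u v Luv; have [uv0|uv0] := eqVneq (u ++ v) [::]; last exact/(retP _ _ Luv uv0).
  by case: u v uv0 {Luv} => [|//] [|//] _; apply: free_return_set_nil.
have /card_gt0P[a _] := A_nonempty.
split; split.
- by move=> [u [v [Luv /eqP uv0 fr]]]; apply: all_free; apply/(retP _ _ Luv uv0).
- by move=> all; exists [:: a], [::]; split; [exact: A_sub_L | by [] | exact/all/A_sub_L].
- by move=> all; apply/(retP [:: a] [::] (A_sub_L a) isT)/all/A_sub_L.
exact: all_free.
Qed.
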